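(* Let $\Gamma=(X,R)$ be a bipartite distance-regular graph with diameter $D\ge 4$, valency $k\ge 3$ and eigenvalues $\theta_0>\theta_1>\cdots>\theta_D$. Put $d=\lfloor D/2\rfloor$, fix $x\in X$ and let $T=T(x)$. Choose $n\in\{1,d\}$ if $D$ is odd, and let $n=1$ if $D$ is even. Define $\eta=\tilde\theta_n=-1-\dfrac{b_2b_3}{\theta_n^2-b_2}$. Then the following three scalars are equal: (i) the scalar $\mu_\eta$, defined as the multiplicity with which $W$ appears in the standard module $V=\mathbb C^X$, where $W$ is a thin irreducible $T$-module with endpoint $2$ and local eigenvalue $\eta$ (and $\mu_\eta=0$ if no such $W$ exists); (ii) the dimension of $U_\eta$; (iii) the scalar $\mathrm{mult}_\eta$, the number of times $\eta$ appears among the local eigenvalues $\eta_{k+1},\eta_{k+2},\ldots,\eta_{k_2}$ of $\Gamma$ with respect to $x$.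
   Context: Graphs are finite, undirected, connected, without loops or multiple edges; $\partial$ denotes path-length distance. A graph $\Gamma=(X,R)$ of diameter $D$ is distance-regular if for all $0\le h,i,j\le D$ and all $x,y\in X$ with $\partial(x,y)=h$ the number $p^h_{ij}=|\{z\in X:\partial(x,z)=i,\ \partial(z,y)=j\}|$ depends only on $h,i,j$. Write $c_i=p^i_{1,i-1}$, $b_i=p^i_{1,i+1}$, $k=b_0$ (the valency), $k_i=p^0_{ii}$. $\Gamma$ is bipartite if $X$ can be partitioned into two subsets neither of which contains an edge. For $0\le i\le D$, $A_i\in\mathrm{Mat}_X(\mathbb C)$ is the $i$th distance matrix: its $(y,z)$ entry is $1$ if $\partial(y,z)=i$ and $0$ otherwise; $A=A_1$ is the adjacency matrix. The distinct eigenvalues of $A$ are $\theta_0>\cdots>\theta_D$ (real). For bipartite $\Gamma$ with $D\ge4$, $\theta_1^2>b_2>\theta_d^2$. $V=\mathbb C^X$ carries the Hermitian inner product $\langle u,v\rangle=u^t\overline v$. For fixed $x\in X$, $E_i^*=E_i^*(x)$ is the diagonal matrix in $\mathrm{Mat}_X(\mathbb C)$ with $(y,y)$ entry $1$ if $\partial(x,y)=i$ and $0$ otherwise. $T=T(x)$ is the subalgebra of $\mathrm{Mat}_X(\mathbb C)$ generated by $A,E_0^*,\ldots,E_D^*$. A $T$-module is a subspace $W\subseteq V$ with $BW\subseteq W$ for all $B\in T$; it is irreducible if it is nonzero and contains no $T$-modules other than $0$ and $W$. The endpoint of an irreducible $W$ is $\min\{i:E_i^*W\ne0\}$; $W$ is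 thin if $\dim E_i^*W\le1$ for $0\le i\le D$. If $W$ is thin irreducible with endpoint $2$, then $E_2^*W$ is a one-dimensional eigenspace for $E_2^*A_2E_2^*$; the corresponding eigenvalue is the local eigenvalue of $W$. $T$-modules $W,W'$ are isomorphic if there is a vector space isomorphism $\sigma:W\to W'$ with $(\sigma B-B\sigma)W=0$ for all $B\in T$. $V$ is an orthogonal direct sum of irreducible $T$-modules; the multiplicity with which an irreducible $T$-module $W$ appears in $V$ is the number of summands in such a decomposition isomorphic to $W$. (All thin irreducible $T$-modules with endpoint 2 and local eigenvalue $\eta=\tilde\theta_n$, $n$ as in the claim, are isomorphic, so $\mu_\eta$ is well defined.) There is a unique irreducible $T$-module $V_0$ with endpoint $0$. Let $Y$ be the span of all irreducible $T$-modules with endpoint $1$. $U$ is the orthogonal complement of $E_2^*V_0+E_2^*Y$ in $E_2^*V$, and for $\eta\in\mathbb R$, $U_\eta=\{v\in U: E_2^*A_2E_2^*v=\eta v\}$. Local eigenvalues: $\Gamma_2^2(x)$ is the graph with vertex set $\{y\in X:\partial(x,y)=2\}$ in which $y,z$ are adjacent iff $\partial(y,z)=2$ (distance in $\Gamma$). It has $k_2$ vertices. The eigenvalues (with multiplicity) $\eta_1,\ldots,\eta_{k_2}$ of its adjacency matrix are the local eigenvalues of $\Gamma$ with respect to $x$; it is known that they can be ordered so that $\eta_1=p^2_{22}$ and $\eta_i=b_3-1$ for $2\le i\le k$, and this ordering is assumed. *)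

(* Defs.v *)
From HB Require Import structures.
From mathcomp Require Import all_boot all_order all_algebra.
From mathcomp Require Import boolp classical_sets reals.
From mathcomp Require Import complex.

Set Implicit Arguments.
Unset Strict Implicit.
Unset Printing Implicit Defensive.
Import Order.TTheory GRing.Theory Num.Theory.
Local Open Scope ring_scope.

Section Graphs.
Variables (X : finType) (e : rel X).

Definition simple_connected_graph : Prop :=
  [/\ symmetric e, irreflexive e & forall y z, connect e y z].

(* Least length of an [e]-path from [y] to [z]; equal to [#|X|] (an impossible
   length for a shortest path) when [z] cannot be reached from [y]. *)
Definition gdist (y z : X) : nat :=
  find (fun l => [exists p : l.-tuple X, path e y p && (last y p == z)])
       (iota 0 #|X|).

Definition diameter : nat := (\max_(y : X) \max_(z : X) gdist y z)%N.

Definition num_between (i j : nat) (y z : X) : nat :=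
  #|[set w | (gdist y w == i) && (gdist w z == j)]|.

Definition distance_regular : Prop :=
  simple_connected_graph /\
  forall h i j : nat,
    (h <= diameter)%N -> (i <= diameter)%N -> (j <= diameter)%N ->
  forall y z y' z' : X, gdist y z = h -> gdist y' z' = h ->
    num_between i j y z = num_between i j y' z'.

(* The number p^h_(i,j), read off on some pair of vertices at distance [h];
   the choice of the pair is irrelevant in a distance-regular graph. *)
Definition inter_num (h i j : nat) : nat :=
  if [pick yz : X * X | gdist yz.1 yz.2 == h] is Some yz
  then num_between i j yz.1 yz.2 else 0%N.

Definition b_num (i : nat) : nat := inter_num i 1 i.+1.

Definition valency : nat := b_num 0.

Definition bipartite : Prop :=
  exists P : {set X}, forall y z : X, e y z ->
    ~~ ((y \in P) && (z \in P)) && ~~ ((y \in ~: P) && (z \in ~: P)).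

End Graphs.

(* Matrices and vectors indexed by the vertex set use the enumeration
   [enum_val : 'I_#|X| -> X]. *)
Definition dist_mx (K : pzRingType) (X : finType) (e : rel X) (i : nat) :
    'M[K]_#|X| :=
  \matrix_(r, s) (gdist e (enum_val r) (enum_val s) == i)%:R.

(* Adjacency matrix of the graph on the vertices at distance 2 from [x], where
   two vertices are adjacent iff their distance in the whole graph is 2. *)
Definition local_adj_mx (K : pzRingType) (X : finType) (e : rel X) (x : X) :
    'M[K]_#|{: {y : X | gdist e x y == 2}}| :=
  \matrix_(r, s)
    (gdist e (val (enum_val r)) (val (enum_val s)) == 2)%:R.

(* [etas] lists eta_1, eta_2, ... from position 0 on. *)
Definition ordered_local_eigenvalues (K : comNzRingType) (X : finType)
    (e : rel X) (x : X) (etas : seq K) : Prop :=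
  [/\ char_poly (local_adj_mx K e x) = \prod_(a <- etas) ('X - a%:P),
      etas`_0 = (inter_num e 2 2 2)%:R
    & forall i : nat, (2 <= i <= valency e)%N ->
        etas`_i.-1 = (b_num e 3)%:R - 1].

(* The number of occurrences among eta_(k+1), eta_(k+2), ... *)
Definition mult_local (K : eqType) (X : finType) (e : rel X) (etas : seq K)
    (eta : K) : nat :=
  count_mem eta (drop (valency e) etas).

Section TerwilligerAlgebra.
Variables (K : numClosedFieldType) (X : finType) (e : rel X) (x : X).

Local Notation V := 'cV[K]_#|X|.
Local Notation Mat := 'M[K]_#|X|.

Definition inner (u v : V) : K := (u^T *m map_mx Num.conj v) 0 0.

Definition Estar (i : nat) : Mat :=
  diag_mx (\row_r (gdist e x (enum_val r) == i)%:R).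

(* The identity is the sum of the [Estar i], so it need not be listed. *)
Inductive in_T : Mat -> Prop :=
| in_T_adj : in_T (dist_mx K e 1)
| in_T_Estar i : (i <= diameter e)%N -> in_T (Estar i)
| in_T_scale a B : in_T B -> in_T (a *: B)
| in_T_add B B' : in_T B -> in_T B' -> in_T (B + B')
| in_T_mul B B' : in_T B -> in_T B' -> in_T (B *m B').

Definition mxact (B : Mat) : 'End(V) := linfun (mulmx B).

Definition T_module (W : {vspace V}) : Prop :=
  forall B, in_T B -> (mxact B @: W <= W)%VS.

Definition T_irreducible (W : {vspace V}) : Prop :=
  [/\ T_module W, W != 0%VS
    & forall W' : {vspace V}, T_module W' -> (W' <= W)%VS ->
        W' = 0%VS \/ W' = W].

Definition Estar_im (i : nat) (W : {vspace V}) : {vspace V} :=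
  (mxact (Estar i) @: W)%VS.

Definition endpoint (W : {vspace V}) : nat :=
  find (fun i => Estar_im i W != 0%VS) (iota 0 (diameter e).+1).

Definition thin (W : {vspace V}) : Prop :=
  forall i, (i <= diameter e)%N -> (\dim (Estar_im i W) <= 1)%N.

Definition local_op : Mat := Estar 2 *m dist_mx K e 2 *m Estar 2.

(* For [W] thin irreducible with endpoint 2, [Estar_im 2 W] is a line, so that
   at most one [eta] qualifies. *)
Definition has_local_eigenvalue (W : {vspace V}) (eta : K) : Prop :=
  (Estar_im 2 W <= passmx.leigenspace (mxact local_op) eta)%VS.

Definition thin_endpoint2 (eta : K) (W : {vspace V}) : Prop :=
  [/\ T_irreducible W, endpoint W = 2, thin W & has_local_eigenvalue W eta].

(* A linear map on [W] is given as the restriction of an endomorphism of V. *)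
Definition T_isomorphic (W W' : {vspace V}) : Prop :=
  exists sigma : 'End(V),
    [/\ {in W &, injective sigma}, (sigma @: W)%VS = W'
      & forall B, in_T B -> {in W, forall w, sigma (B *m w) = B *m sigma w}].

Definition orth_decomposition (Ws : seq {vspace V}) : Prop :=
  [/\ forall W, W \in Ws -> T_irreducible W,
      forall i j : nat, (i < size Ws)%N -> (j < size Ws)%N -> i != j ->
        forall u v, u \in nth 0%VS Ws i -> v \in nth 0%VS Ws j -> inner u v = 0
    & (\sum_(W <- Ws) W)%VS = fullv].

(* The number of summands isomorphic to [W] does not depend on the
   decomposition, and decompositions exist. *)
Definition multiplicity (W : {vspace V}) : nat :=
  xget 0%N [set m | exists2 Ws, orth_decomposition Ws
                  & m = count (fun W' => `[< T_isomorphic W W' >]) Ws]%classic.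

(* 0 when there is no suitable [W]. *)
Definition mu (eta : K) : nat :=
  xget 0%N [set m | exists2 W, thin_endpoint2 eta W
                  & m = multiplicity W]%classic.

(* The subspace with underlying set [P]; junk unless [P] is a subspace. *)
Definition vspace_of (P : V -> Prop) : {vspace V} :=
  xget 0%VS [set W : {vspace V} | forall v, v \in W <-> P v]%classic.

Definition V0 : {vspace V} :=
  xget 0%VS [set W | T_irreducible W /\ endpoint W = 0%N]%classic.

(* The span of the irreducible modules with endpoint 1, as the intersection of
   all subspaces containing them. *)
Definition Yspan : {vspace V} :=
  vspace_of (fun v => forall S : {vspace V},
    (forall W, T_irreducible W -> endpoint W = 1%N -> (W <= S)%VS) -> v \in S).

Definition Uspace : {vspace V} :=
  vspace_of (fun v => v \in Estar_im 2 fullv /\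
    forall w, w \in (Estar_im 2 V0 + Estar_im 2 Yspan)%VS -> inner v w = 0).

Definition Ueta (eta : K) : {vspace V} :=
  (Uspace :&: passmx.leigenspace (mxact local_op) eta)%VS.

End TerwilligerAlgebra.

(* Main.v *)
Require Import Defs.
From mathcomp Require Import all_boot all_order all_algebra.
From mathcomp Require Import boolp classical_sets reals.
From mathcomp Require Import complex zify ring.
Import Order.TTheory GRing.Theory Num.Theory.
Local Open Scope ring_scope.

Set Implicit Arguments.
Unset Strict Implicit.
Unset Printing Implicit Defensive.

(** Write [A i] for the distance matrices, [Es i] for the projections onto the
    spheres around [x], [b] and [c] for the intersection numbers, and let [v] be
    a nonzero vector of [Ueta].

    The space [U] consists of the vectors on the second sphere that are killed by
    the lowering map [Es 1 *m A 1] ([lowestP]), because the modules of endpoint 0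
    and 1 meet the second sphere exactly in the image of the first sphere under
    raising.  Membership in [Ueta] is thus expressed by equations in the algebra
    [T], so that the components of [v] in a direct sum of modules lie in [Ueta]
    again.

    The heart of the matter is that [v] generates a thin irreducible module whose
    structure depends on [eta] only.  Since the graph is bipartite, the part of
    the algebra of distance matrices seen by [v] on the sphere of radius [i]
    consists of the three vectors [Es i *m (A j *m v)] with [j] equal to [i - 2],
    [i] or [i + 2].  Their sum is zero, as [v] is orthogonal to the all-one
    vector.  A second relation comes from the eigenvalue [t = theta n]: if [u] is
    its cosine sequence, the squared norm of the projection of [v] onto the
    eigenspace is a multiple of [1 + eta * u 2 - (1 + eta) * u 4], and [eta] is
    defined so as to make this zero ([eta_cosine], [local_eigenvector_orth]).
    Hence [u (i - 2)], [u i] and [u (i + 2)] are the coefficients of another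
    relation between the three vectors, and all three are multiples of the first
    one as soon as [u i] differs from [u (i + 2)] ([seed2]).

    This inequality is where the position of [theta n] in the spectrum enters
    ([cosine_neq]).  If no eigenvalue lies strictly between [t] and [t'], then
    [(t - A 1) *m (t' - A 1)] is positive semidefinite; evaluated at a vector
    glued from eigensequences of [t] and of [t'], it gives the sign of one
    product ([glued_eigenseq_ge0]).  For [theta 1] the neighbour [t'] is the valency, for
    the least positive eigenvalue it is [- t].

    Once one vector per sphere suffices, a general computation produces the
    module: if [Es (r + s) *m (A s.+2 *m v)] is a multiple of
    [chain v s = Es (r + s) *m (A s *m v)] for all [s], then the vectors
    [chain v s] are raised and lowered into each other with coefficients that do
    not depend on [v] ([chain_raise], [chain_lower]).  Their span is thin and
    irreducible, and two such spans are isomorphic ([chain_mod_irr],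
    [chain_mod_iso]).  The same computation describes the modules of endpoint 0
    and 1.  An irreducible summand of the standard module therefore meets [Ueta]
    in a line or in zero, according to whether it is isomorphic to the module in
    question, and adding up the dimensions gives the equality of [mu] and
    [\dim (Ueta e x eta)] ([mu_dim]).

    The second equality is a count of eigenvalues.  The second sphere is the
    orthogonal sum of the line spanned by its characteristic vector, of a space of
    dimension [valency e - 1] coming from endpoint 1, and of [U]
    ([parts_orth], [parts_sum]).  The local operator is the scalar
    [inter_num e 2 2 2] on the first and [b 3 - 1] on the second, and these are
    the first [valency e] local eigenvalues.  As a real symmetric matrix is
    diagonalizable, what remains of the characteristic polynomial counts the
    eigenvectors in [U] ([dim_Ueta_mult]). *)

(** * Distances in a connected graph *)

Section GraphDistance.
Variables (X : finType) (e : rel X).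
Hypothesis conn : simple_connected_graph e.

Local Notation d := (gdist e).
Local Notation D := (diameter e).

Let e_sym : symmetric e. Proof. by case: conn. Qed.

Lemma gdist_path y z :
  exists p, [/\ path e y p, last y p = z & size p = d y z].
Proof.
have [_ _ /(_ y z)/connectP[q pq zq]] := conn.
case: (shortenP pq) zq => p pp up _ zp.
pose P := fun l => [exists p : l.-tuple X, path e y p && (last y p == z)].
have szp : (size p < #|X|)%N by rewrite -[_.+1]/(size (y :: p)) -(card_uniqP up) max_card.
have hasP : has P (iota 0 #|X|).
  apply/hasP; exists (size p); first by rewrite mem_iota add0n.
  by rewrite /P; apply/existsP; exists (in_tuple p); rewrite /= pp -zp eqxx.
have := nth_find 0%N hasP; rewrite -[find _ _]/(d y z).
rewrite nth_iota ?add0n; last by move: hasP; rewrite has_find size_iota.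
rewrite /P => /existsP[r /andP[pr /eqP zr]]; exists r; split=> //; exact: size_tuple.
Qed.

Lemma gdist_le y p : path e y p -> (d y (last y p) <= size p)%N.
Proof.
move=> pp; rewrite leqNgt; apply/negP=> lt_pd.
have szX : (size p < #|X|)%N.
  by apply: leq_trans lt_pd _; rewrite -[X in (_ <= X)%N](size_iota 0 #|X|) find_size.
have /(_ 0%N) := before_find _ lt_pd.
rewrite nth_iota // add0n => /negbT/negP; apply.
by apply/existsP; exists (in_tuple p); rewrite /= pp eqxx.
Qed.

Lemma gdist_eq0 y z : (d y z == 0%N) = (y == z).
Proof.
apply/eqP/eqP=> [|->]; last first.
  by apply/eqP; rewrite -leqn0; apply: (@gdist_le z [::]).
by have [[|w p] [_ <- <-]] := gdist_path y z.
Qed.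

Lemma gdistxx y : d y y = 0%N. Proof. by apply/eqP; rewrite gdist_eq0. Qed.

Lemma gdist_triangle y w z : (d y z <= d y w + d w z)%N.
Proof.
have [p [pp pw <-]] := gdist_path y w; have [q [qp qz <-]] := gdist_path w z.
rewrite -size_cat -qz -pw -last_cat; apply: gdist_le.
by rewrite cat_path pp pw.
Qed.

Lemma gdist_sym y z : d y z = d z y.
Proof.
suff le u v : (d u v <= d v u)%N by apply/eqP; rewrite eqn_leq !le.
have [p [pp pu <-]] := gdist_path v u.
have := rev_path e v p; rewrite (eq_path (e' := e)); last by move=> a b; rewrite e_sym.
rewrite pp pu => /gdist_le; rewrite size_rev size_belast.
suff -> : last u (rev (belast v p)) = v by [].
rewrite -{}pu; case: p pp => //= a p _.
by rewrite rev_cons last_rcons.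
Qed.

Lemma gdist_eq1 y z : (d y z == 1%N) = e y z.
Proof.
apply/eqP/idP=> [] eyz.
  by have [[|w [|w' p]] []] := gdist_path y z; rewrite eyz //= => /andP[eyw _] <-.
apply/eqP; rewrite eqn_leq (@gdist_le y [:: z]) ?lt0n ?gdist_eq0 /= ?eyz //.
by apply: contraL eyz => /eqP <-; case: conn => _ ->.
Qed.

Lemma gdist_diameter y z : (d y z <= D)%N.
Proof.
apply: leq_trans (leq_bigmax z) _.
exact: (leq_bigmax (F := fun y => \max_z d y z) y).
Qed.

Lemma gdist_step y z h : d y z = h.+1 -> exists2 w, d y w = 1%N & d w z = h.
Proof.
move=> dyz; have [[|w p] []] := gdist_path y z; rewrite dyz // => /andP[eyw pp] lp [szp].
move: eyw; rewrite -gdist_eq1 => /eqP dyw; exists w => //.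
apply/eqP; rewrite eqn_leq; have := gdist_triangle y w z.
by have := gdist_le pp; rewrite [last w p]lp; lia.
Qed.

(** Walk along a geodesic of maximal length. *)
Lemma gdist_onto (x : X) h : (h <= D)%N -> exists y z, d y z = h.
Proof.
have [y Dy] : exists y, D = \max_z d y z.
  rewrite /diameter; have [|y ->] := @bigop.eq_bigmax _ (fun y => \max_z d y z)%N.
    by apply/card_gt0P; exists x.
  by exists y.
have [z Dz] : exists z, D = d y z.
  rewrite Dy; have [|z ->] := @bigop.eq_bigmax _ (fun z => d y z).
    by apply/card_gt0P; exists x.
  by exists z.
have [m yz] : exists m, d y z = m by exists (d y z).
rewrite Dz yz; elim: m y {Dy Dz} yz => [|m IHm] u uz.
  by rewrite leqn0 => /eqP ->; exists u, z.
rewrite leq_eqVlt => /predU1P[-> | ]; first by exists u, z.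
by have [w _ /IHm] := gdist_step uz.
Qed.

Section Bipartite.
Hypothesis bip : bipartite e.

(** Every step of a path changes the side of the bipartition, so the parity of a
    distance tells whether its ends are on the same side. *)
Lemma gdist_parity y w z : ~~ odd (d y w + d w z + d y z).
Proof.
have [P halves] := bip.
have par u v : odd (d u v) = (u \in P) (+) (v \in P).
  have [p [pp <- <-]] := gdist_path u v.
  elim: p u pp => [|a p IHp] u /=; first by rewrite addbb.
  case/andP=> /halves; rewrite !inE => ua /IHp ->.
  by case: (u \in P) (a \in P) ua => [] [] //=; rewrite ?negbK.
by rewrite !oddD !par; case: (y \in P) (w \in P) (z \in P) => [] [] [].
Qed.

End Bipartite.

End GraphDistance.

(** * Intersection numbers *)

Section IntersectionNumbers.
Variables (X : finType) (e : rel X).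
Hypothesis Gamma_dr : distance_regular e.

Local Notation d := (gdist e).
Local Notation D := (diameter e).

Let conn : simple_connected_graph e. Proof. by case: Gamma_dr. Qed.

(** This holds for all [i] and [j], as both sides vanish beyond the diameter. *)
Lemma num_betweenE i j y z : num_between e i j y z = inter_num e (d y z) i j.
Proof.
have [/andP[iD jD]|ijD] := boolP ((i <= D)%N && (j <= D)%N).
  rewrite /inter_num; case: pickP => [[u v] /= /eqP uv | /(_ (y, z))/=]; last by rewrite eqxx.
  by case: Gamma_dr => _ /(_ (d y z) i j); apply; rewrite ?gdist_diameter.
have none u v : num_between e i j u v = 0%N.
  apply/eqP; rewrite cards_eq0; apply/eqP/setP=> w; rewrite !inE.
  apply/negP=> /andP[/eqP ui /eqP vj]; move: ijD.
  by rewrite -ui -vj !gdist_diameter.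
by rewrite none /inter_num; case: pickP.
Qed.

(** At [i = 0] the truncated predecessor gives the number of vertices that are
    both at distance 1 and at distance 0, hence 0. *)
Definition c_num i := inter_num e i 1 i.-1.

Lemma inter_num_far h i j : (D < j)%N -> inter_num e h i j = 0%N.
Proof.
rewrite /inter_num; case: pickP => // -[y z] _ /= Dj.
apply/eqP; rewrite cards_eq0; apply/eqP/setP=> w; rewrite !inE.
by apply/negP=> /andP[_ /eqP zj]; move: Dj; rewrite -zj ltnNge gdist_diameter.
Qed.

Lemma inter_num_gt0 y w z : (0 < inter_num e (d y z) (d y w) (d w z))%N.
Proof. by rewrite -num_betweenE card_gt0; apply/set0Pn; exists w; rewrite inE !eqxx. Qed.

Variable x : X.

Lemma c_num0 : c_num 0 = 0%N.
Proof.
rewrite /c_num -(gdistxx conn x) -num_betweenE gdistxx //.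
apply/eqP; rewrite cards_eq0; apply/eqP/setP=> w; rewrite !inE.
by rewrite (gdist_eq0 conn w x); case: (w =P x) => [->|]; rewrite ?gdistxx ?andbF.
Qed.

Lemma c_num_gt0 i : (0 < i <= D)%N -> (0 < c_num i)%N.
Proof.
case: i => // i /= iD; have [y [z yz]] := gdist_onto conn x iD.
have [w yw wz] := gdist_step conn yz.
by have := inter_num_gt0 y w z; rewrite yz yw wz.
Qed.

Lemma b_num_gt0 i : (i < D)%N -> (0 < b_num e i)%N.
Proof.
move=> iD; have [y [z yz]] := gdist_onto conn x iD.
have [w yw wz] := gdist_step conn yz.
by have := inter_num_gt0 w y z; rewrite (gdist_sym conn w y) yz yw wz.
Qed.

Lemma b_num_far i : (D <= i)%N -> b_num e i = 0%N.
Proof. by move=> Di; apply: inter_num_far. Qed.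

Lemma c_num1 : (0 < D)%N -> c_num 1 = 1%N.
Proof.
move=> D0; have [y [z yz]] := gdist_onto conn x D0.
suff : num_between e 1 0 y z = 1%N by rewrite num_betweenE yz.
rewrite -[RHS](cards1 z); apply: eq_card => w; rewrite !inE.
by rewrite [d w z == _](gdist_eq0 conn w z); case: (w =P z) => [->|]; rewrite ?yz ?andbF.
Qed.

Hypothesis bip : bipartite e.

Lemma gdist_nbr y w z : d y w = 1%N ->
  (d w z == (d y z).+1) || (d w z == (d y z).-1) && (0 < d y z)%N.
Proof.
move=> yw; have := gdist_parity conn bip y w z.
have := gdist_triangle conn y w z; have := gdist_triangle conn w y z.
rewrite (gdist_sym conn w y) yw; move: (d y z) (d w z) => m n; lia.
Qed.

Lemma bc_valency i : (i <= D)%N -> (b_num e i + c_num i = valency e)%N.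
Proof.
move=> /(gdist_onto conn x)[y [z <-]]; rewrite /b_num /c_num.
rewrite -!num_betweenE.
have -> : valency e = num_between e 1 1 y y by rewrite num_betweenE gdistxx.
rewrite /num_between -cardsUI.
rewrite [X in (_ + X)%N](_ : _ = 0%N) ?addn0; last first.
  apply/eqP; rewrite cards_eq0; apply/eqP/setP=> w; rewrite !inE; apply/negP.
  by case/andP=> /andP[_ /eqP->] /andP[_]; lia.
congr #|pred_of_set _|; apply/setP=> w; rewrite !inE (gdist_sym conn w y).
case: (d y w =P 1%N) => //= yw; have := gdist_nbr z yw.
case/orP=> [-> //|/andP[-> _]]; exact: orbT.
Qed.

End IntersectionNumbers.

(** * The Hermitian form *)

Section Inner.
Variables (K : numClosedFieldType) (X : finType).
Local Notation V := 'cV[K]_#|X|.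
Implicit Types u v w : V.

Lemma innerE u v : inner u v = \sum_r u r 0 * Num.conj (v r 0).
Proof. by rewrite /inner mxE; apply: eq_bigr => r _; rewrite !mxE. Qed.

Lemma innerDl u v w : inner (u + v) w = inner u w + inner v w.
Proof. by rewrite !innerE -big_split; apply: eq_bigr => r _; rewrite mxE mulrDl. Qed.

Lemma innerZl a u v : inner (a *: u) v = a * inner u v.
Proof. by rewrite !innerE mulr_sumr; apply: eq_bigr => r _; rewrite mxE mulrA. Qed.

Lemma inner0l v : inner 0 v = 0.
Proof. by rewrite -(scale0r 0) innerZl mul0r. Qed.

Lemma inner_suml I (r : seq I) (P : pred I) (F : I -> V) v :
  inner (\sum_(i <- r | P i) F i) v = \sum_(i <- r | P i) inner (F i) v.
Proof.
by elim/big_rec2: _ => [|i a b _ <-]; rewrite ?inner0l ?innerDl.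
Qed.

Lemma innerC u v : inner u v = Num.conj (inner v u).
Proof.
rewrite !innerE rmorph_sum; apply: eq_bigr => r _ /=.
by rewrite rmorphM /= conjCK mulrC.
Qed.

Lemma innerDr u v w : inner u (v + w) = inner u v + inner u w.
Proof. by rewrite innerC innerDl rmorphD /= -!innerC. Qed.

Lemma innerZr a u v : inner u (a *: v) = Num.conj a * inner u v.
Proof. by rewrite innerC innerZl rmorphM /= -!innerC. Qed.

Lemma inner0r v : inner v 0 = 0.
Proof. by rewrite innerC inner0l rmorph0. Qed.

Lemma inner_sumr I (r : seq I) (P : pred I) (F : I -> V) v :
  inner v (\sum_(i <- r | P i) F i) = \sum_(i <- r | P i) inner v (F i).
Proof. by elim/big_rec2: _ => [|i a b _ <-]; rewrite ?inner0r ?innerDr. Qed.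

Lemma inner_ge0 u : 0 <= inner u u.
Proof. by rewrite innerE sumr_ge0 // => r _; apply: mul_conjC_ge0. Qed.

Lemma inner_eq0 u : (inner u u == 0) = (u == 0).
Proof.
apply/eqP/eqP=> [|->]; last exact: inner0l.
rewrite innerE => /psumr_eq0P uu0; apply/colP=> r; rewrite mxE.
by apply/eqP; rewrite -mul_conjC_eq0 uu0 // => s _; apply: mul_conjC_ge0.
Qed.

Lemma inner_mull (B : 'M[K]_#|X|) u v :
  B^T = B -> map_mx Num.conj B = B -> inner (B *m u) v = inner u (B *m v).
Proof.
move=> Bt Bc; rewrite /inner trmx_mul Bt map_mxM Bc; congr (_ 0 0).
by rewrite mulmxA.
Qed.

End Inner.

(** * Distance matrices and projections onto spheres *)

Section DistanceMatrices.
Variables (K : numClosedFieldType) (X : finType) (e : rel X) (x : X).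
Hypothesis Gamma_dr : distance_regular e.
Hypothesis bip : bipartite e.

Local Notation d := (gdist e).
Local Notation D := (diameter e).
Local Notation ev := (@enum_val X X).
Local Notation A := (dist_mx K e).
Local Notation Es := (Estar K e x).
Local Notation b i := (b_num e i)%:R.
Local Notation c i := (c_num e i)%:R.

Let conn : simple_connected_graph e. Proof. by case: Gamma_dr. Qed.

Lemma big_enum_val_all (M : nmodType) (F : X -> M) :
  \sum_(r < #|X|) F (enum_val r) = \sum_y F y.
Proof. by rewrite (reindex _ (onW_bij _ (enum_val_bij X))). Qed.

Lemma num_between_sum i j y z :
  (num_between e i j y z)%:R = \sum_w ((d y w == i) && (d w z == j))%:R :> K.
Proof.
rewrite /num_between -sum1dep_card natr_sum big_mkcond /=.
by apply: eq_bigr => w _; case: ifP.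
Qed.

Lemma dist_mx_mul i j :
  A i *m A j = \matrix_(r, s) (num_between e i j (enum_val r) (enum_val s))%:R.
Proof.
apply/matrixP=> r s; rewrite !mxE num_between_sum -big_enum_val_all.
by apply: eq_bigr => w _; rewrite !mxE -natrM mulnb.
Qed.

Lemma dist_mx0 : A 0 = 1%:M.
Proof.
by apply/matrixP=> r s; rewrite !mxE gdist_eq0 // (inj_eq enum_val_inj).
Qed.

(** The middle term of the usual three-term recurrence is absent because in a
    bipartite graph adjacent vertices are never equidistant from a third one. *)
Lemma dist_mx_mulS j : A 1 *m A j.+1 = c j.+2 *: A j.+2 + b j *: A j.
Proof.
rewrite dist_mx_mul; apply/matrixP=> r s; rewrite !mxE.
set y := enum_val r; set z := enum_val s.
have [h_j2|h_j2] := eqVneq (d y z) j.+2.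
  rewrite num_betweenE // h_j2 mulr1.
  by rewrite (_ : (_ == j) = false) ?mulr0 ?addr0 //; lia.
have [h_j|h_j] := eqVneq (d y z) j.
  by rewrite num_betweenE // h_j mulr1 mulr0 add0r.
rewrite !mulr0 addr0; apply/eqP; rewrite pnatr_eq0 cards_eq0.
apply/eqP/setP=> w; rewrite !inE; apply/negP=> /andP[/eqP yw /eqP wz].
have := gdist_nbr Gamma_dr bip z yw; lia.
Qed.

Lemma dist_mx_mul1 : (0 < D)%N -> A 1 *m A 0 = c 1 *: A 1.
Proof. by move=> D0; rewrite dist_mx0 mulmx1 c_num1 // scale1r. Qed.

Lemma dist_mx_far j : (D < j)%N -> A j = 0.
Proof.
move=> Dj; apply/matrixP=> r s; rewrite !mxE; case: eqP => // rs.
by move: Dj; rewrite -rs ltnNge gdist_diameter.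
Qed.

Lemma dist_mx_tr j : (A j)^T = A j.
Proof. by apply/matrixP=> r s; rewrite !mxE gdist_sym. Qed.

Lemma dist_mx_conj j : map_mx Num.conj (A j) = A j.
Proof. by apply/matrixP=> r s; rewrite !mxE rmorph_nat. Qed.

Lemma sum_dist_mx : \sum_(j < D.+1) A j = const_mx 1.
Proof.
apply/matrixP=> r s; rewrite summxE mxE.
have lt_rs : (d (ev r) (ev s) < D.+1)%N by rewrite ltnS gdist_diameter.
rewrite (bigD1 (Ordinal lt_rs)) //= mxE eqxx big1 ?addr0 // => j.
by rewrite mxE -val_eqE /= eq_sym => /negPf->.
Qed.

Lemma EstarE i m (M : 'M_(#|X|, m)) r s :
  (Es i *m M) r s = (d x (enum_val r) == i)%:R * M r s.
Proof. by rewrite mul_diag_mx !mxE. Qed.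

Lemma EstarK i m (M : 'M_(#|X|, m)) : Es i *m (Es i *m M) = Es i *m M.
Proof. by apply/matrixP=> r s; rewrite !EstarE; case: eqP; rewrite ?mul0r ?mul1r. Qed.

Lemma Estar_orth i j m (M : 'M_(#|X|, m)) :
  i != j -> Es i *m (Es j *m M) = 0.
Proof.
move=> ij; apply/matrixP=> r s; rewrite !EstarE mxE.
by case: eqP => [->|_]; rewrite ?(negPf ij) ?mul0r ?mulr0.
Qed.

Lemma Estar_far i m (M : 'M_(#|X|, m)) : (D < i)%N -> Es i *m M = 0.
Proof.
move=> Di; apply/matrixP=> r s; rewrite EstarE mxE.
by case: eqP => [xr|_]; rewrite ?mul0r //; move: Di; rewrite -xr ltnNge gdist_diameter.
Qed.

Lemma sum_Estar m (M : 'M_(#|X|, m)) : \sum_(i < D.+1) Es i *m M = M.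
Proof.
apply/matrixP=> r s; rewrite summxE.
have lt_rs : (d x (ev r) < D.+1)%N by rewrite ltnS gdist_diameter.
rewrite (bigD1 (Ordinal lt_rs)) //= EstarE eqxx mul1r big1 ?addr0 // => j.
by rewrite EstarE -val_eqE /= eq_sym => /negPf->; rewrite mul0r.
Qed.

Lemma Estar_tr i : (Es i)^T = Es i.
Proof. exact: tr_diag_mx. Qed.

Lemma Estar_conj i : map_mx Num.conj (Es i) = Es i.
Proof. by apply/matrixP=> r s; rewrite !mxE rmorphMn /= rmorph_nat. Qed.

Lemma inner_dist j (u v : 'cV_#|X|) : inner (A j *m u) v = inner u (A j *m v).
Proof. by apply: inner_mull; [apply: dist_mx_tr | apply: dist_mx_conj]. Qed.

Lemma inner_Estar i (u v : 'cV_#|X|) : inner (Es i *m u) v = inner u (Es i *m v).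
Proof. by apply: inner_mull; [apply: Estar_tr | apply: Estar_conj]. Qed.

(** The triangle inequality and the parity of distances. *)
Lemma Estar_dist_Estar i j h m (M : 'M_(#|X|, m)) :
  ~~ [&& (i <= j + h)%N, (j <= i + h)%N, (h <= i + j)%N & ~~ odd (i + j + h)] ->
  Es i *m (A j *m (Es h *m M)) = 0.
Proof.
move=> ijh; rewrite !mulmxA.
suff -> : Es i *m A j *m Es h = 0 by rewrite mul0mx.
apply/matrixP=> r s; rewrite mul_mx_diag mxE EstarE !mxE -!natrM.
rewrite !mulnb; case: andP => // -[/andP[/eqP xr /eqP rs] /eqP xs].
move: ijh; rewrite -xr -rs -xs {4}(gdist_sym conn x (ev r)).
have := gdist_parity conn bip x (ev r) (ev s).
have := gdist_triangle conn x (ev r) (ev s).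
have := gdist_triangle conn x (ev s) (ev r).
have := gdist_triangle conn (ev r) x (ev s).
rewrite !(gdist_sym conn (ev r) x) !(gdist_sym conn (ev s) (ev r)).
move: (d x (ev r)) (d x (ev s)) (d (ev r) (ev s)) => i1 h1 j1; lia.
Qed.

(** For [i = 0] the second summand is [Es 0 *m (A 1 *m (Es 0 *m M))], which
    vanishes, so that one formula serves for all spheres. *)
Lemma Estar_nbr i m (M : 'M_(#|X|, m)) :
  Es i *m (A 1 *m M) =
  Es i *m (A 1 *m (Es i.+1 *m M)) + Es i *m (A 1 *m (Es i.-1 *m M)).
Proof.
rewrite -!mulmxDr -mulmxDl; rewrite !mulmxA; congr (_ *m M).
rewrite -mulmxA; apply/matrixP=> r s; rewrite !EstarE.
case: eqP => // xr; rewrite ?mul0r // !mul1r.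
rewrite mulmxDr !mxE.
rewrite (bigD1 s) //= big1 ?addr0; last first.
  by move=> t ts; rewrite !mxE (negPf ts) mulr0.
rewrite [X in _ + X](bigD1 s) //= big1 ?addr0; last first.
  by move=> t ts; rewrite !mxE (negPf ts) mulr0.
rewrite !mxE eqxx !mulr1n -!natrM -natrD; case: eqP => // rs.
have := gdist_nbr Gamma_dr bip x rs.
rewrite !(gdist_sym conn _ x) xr !mul1n.
by move: (d x (ev s)) => h; case: i {xr} => [|i] ih; congr _%:R; lia.
Qed.

Lemma dist_split i m (M : 'M_(#|X|, m)) : Es i *m M = M ->
  A 1 *m M = Es i.+1 *m (A 1 *m M) + Es i.-1 *m (A 1 *m M).
Proof.
move=> iM; rewrite -{1 2 3}iM.
have /(congr1 trmx) := Estar_nbr i (1%:M : 'M_#|X|).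
rewrite linearD /= !mulmx1 !trmx_mul !Estar_tr !dist_mx_tr => E1.
by rewrite [LHS]mulmxA [in LHS]E1 mulmxDl -!mulmxA.
Qed.

End DistanceMatrices.

(** * Modules spanned by a chain of vectors *)

Section Modules.
Variables (K : numClosedFieldType) (X : finType) (e : rel X) (x : X).
Hypothesis Gamma_dr : distance_regular e.
Hypothesis bip : bipartite e.
Hypothesis D_gt0 : (0 < diameter e)%N.

Local Notation V := 'cV[K]_#|X|.
Local Notation d := (gdist e).
Local Notation D := (diameter e).
Local Notation A := (dist_mx K e).
Local Notation Es := (Estar K e x).
Local Notation b i := (b_num e i)%:R.
Local Notation c i := (c_num e i)%:R.
Local Notation T_module := (@T_module K X e x).
Local Notation T_irreducible := (@T_irreducible K X e x).
Local Notation Estar_im := (@Estar_im K X e x).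
Local Notation endpoint := (@endpoint K X e x).

Let conn : simple_connected_graph e. Proof. by case: Gamma_dr. Qed.

Lemma c_neq0 s : (s < D)%N -> c s.+1 != 0 :> K.
Proof. by move=> sD; rewrite pnatr_eq0 -lt0n (c_num_gt0 Gamma_dr x). Qed.

Lemma b_neq0 s : (s < D)%N -> b s != 0 :> K.
Proof. by move=> sD; rewrite pnatr_eq0 -lt0n (b_num_gt0 Gamma_dr x). Qed.

Lemma memv_scale k (v : V) (W : {vspace V}) : k != 0 -> (k *: v \in W) = (v \in W).
Proof. by move=> k0; rewrite rpredZeq (negPf k0). Qed.

Lemma mxactE (B : 'M_#|X|) (v : V) : mxact B v = B *m v.
Proof. by rewrite lfunE. Qed.

Lemma T_moduleP (W : {vspace V}) :
  T_module W <-> (forall w, w \in W -> A 1 *m w \in W) /\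
                 (forall i w, w \in W -> Es i *m w \in W).
Proof.
split=> [Wmod|[WA WE] B].
  have stable B w : in_T e x B -> w \in W -> B *m w \in W.
    by move=> TB Ww; rewrite -mxactE (subvP (Wmod B TB)) // memv_img.
  split=> [w|i w Ww]; first by apply: stable; constructor.
  have [iD|Di] := leqP i D; first by apply: stable => //; constructor.
  by rewrite Estar_far ?mem0v.
move=> TB; apply/subvP=> _ /memv_imgP[w Ww ->]; rewrite mxactE.
elim: TB w Ww => [|i _|a C _ IHC|C C' _ IHC _ IHC'|C C' _ IHC _ IHC'] w Ww.
- exact: WA.
- exact: WE.
- by rewrite -scalemxAl memvZ ?IHC.
- by rewrite mulmxDl memvD ?IHC ?IHC'.
- by rewrite -mulmxA IHC ?IHC'.
Qed.

Lemma Estar_imP i (W : {vspace V}) u :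
  reflect (exists2 w, w \in W & u = Es i *m w) (u \in Estar_im i W).
Proof.
apply: (iffP memv_imgP) => -[w Ww ->]; exists w; rewrite ?mxactE //.
Qed.

Lemma endpointP (W : {vspace V}) : W != 0%VS ->
  [/\ (endpoint W <= D)%N, Estar_im (endpoint W) W != 0%VS &
      forall i, (i < endpoint W)%N -> forall w, w \in W -> Es i *m w = 0].
Proof.
move=> W0; pose P i := Estar_im i W != 0%VS.
have hasP : has P (iota 0 D.+1).
  apply: contraR W0 => /hasPn noP; rewrite -subv0; apply/subvP=> w Ww.
  rewrite memv0 -(sum_Estar e x w) big1 // => i _.
  have /noP : (i : nat) \in iota 0 D.+1 by rewrite mem_iota /= add0n ltn_ord.
  rewrite /P negbK => /eqP Ei0; apply/eqP; rewrite -memv0 -Ei0.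
  by apply/Estar_imP; exists w.
have lt_r : (endpoint W < D.+1)%N by move: hasP; rewrite has_find size_iota.
split=> //; first by have := nth_find 0%N hasP; rewrite -[find _ _]/(endpoint W) nth_iota.
move=> i lt_i w Ww; have := before_find 0%N lt_i.
rewrite nth_iota ?add0n; last exact: ltn_trans lt_i _.
move/negbFE/eqP => Ei0; apply/eqP; rewrite -memv0 -Ei0.
by apply/Estar_imP; exists w.
Qed.

Lemma endpoint_unique (W : {vspace V}) r : (r <= D)%N ->
  Estar_im r W != 0%VS ->
  (forall i, (i < r)%N -> forall w, w \in W -> Es i *m w = 0) ->
  endpoint W = r.
Proof.
move=> rD Er low; have W0 : W != 0%VS.
  by apply: contraNneq Er => ->; rewrite /Defs.Estar_im limg0.
have [_ Ee lowe] := endpointP W0.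
have zero i : (forall w, w \in W -> Es i *m w = 0) -> Estar_im i W = 0%VS.
  move=> Ei; apply/eqP; rewrite -subv0; apply/subvP=> _ /Estar_imP[w Ww ->].
  by rewrite Ei ?mem0v.
case: (ltngtP (endpoint W) r) => // [/low/zero|/lowe/zero] E0.
  by rewrite E0 eqxx in Ee.
by rewrite E0 eqxx in Er.
Qed.

Section Chain.
Variables (r : nat) (g : nat -> K).

(** The third condition is what closes the span of the vectors [chain v s] below:
    lowering [chain v s.+1] produces [Es (r + s) *m (A s.+2 *m v)]. *)
Definition seed (v : V) : Prop :=
  [/\ Es r *m v = v,
      forall i, (i < r)%N -> Es i *m (A 1 *m v) = 0 &
      forall s, Es (r + s) *m (A s.+2 *m v) =
                g s *: (Es (r + s) *m (A s *m v))].

Definition chain (v : V) s : V := Es (r + s) *m (A s *m v).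

(** The lowering coefficients.  At [s = 0] the junk value [g 0.-1] is multiplied
    by [c 0 = 0]. *)
Definition beta s : K := c s.+2 * g s + b s - c s * g s.-1.

Lemma chain_far v s : (D < r + s)%N -> chain v s = 0.
Proof. exact: Estar_far. Qed.

Lemma Estar_chain v s : Es (r + s) *m chain v s = chain v s.
Proof. exact: EstarK. Qed.

Lemma Estar_chain_ne v i s : i != (r + s)%N -> Es i *m chain v s = 0.
Proof. by move=> ?; apply: Estar_orth. Qed.

Section OneSeed.
Variable v : V.
Hypothesis vs : seed v.

Lemma chain0 : chain v 0 = v.
Proof. by case: vs => v_r _ _; rewrite /chain dist_mx0 // mul1mx addn0. Qed.

Lemma Estar_dist_far i j : (r + j < i)%N -> Es i *m (A j *m v) = 0.
Proof.
by case: vs => v_r _ _ ij; rewrite -v_r Estar_dist_Estar //; apply/negP; lia.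
Qed.

(** Apply [Es (r + s).+1] to the recurrence for [A 1 *m A s]: only the two
    extreme distances survive. *)
Lemma chain_raise s :
  Es (r + s).+1 *m (A 1 *m chain v s) = c s.+1 *: chain v s.+1.
Proof.
have -> : Es (r + s).+1 *m (A 1 *m chain v s) =
    Es (r + s).+1 *m (A 1 *m (A s *m v)).
  rewrite [RHS]Estar_nbr // /= Estar_dist_far; last lia.
  by rewrite !mulmx0 add0r.
rewrite [A 1 *m (A s *m v)]mulmxA /chain addnS.
case: s => [|s].
  by rewrite dist_mx_mul1 // -scalemxAl -scalemxAr.
rewrite dist_mx_mulS // mulmxDl mulmxDr -!scalemxAl -!scalemxAr.
by rewrite (@Estar_dist_far _ s) ?scaler0 ?addr0 //; lia.
Qed.

(** Apply [Es (r + s)] to the recurrence for [A 1 *m A s.+1].  On the next sphere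
    [A s.+1 *m v] is the chain; on the previous one it is a multiple of the chain
    by the definition of a seed, and raising the chain is known. *)
Lemma chain_lower s : Es (r + s) *m (A 1 *m chain v s.+1) = beta s *: chain v s.
Proof.
case: (vs) => v_r low pair.
have := Estar_nbr x Gamma_dr bip (r + s) (A s.+1 *m v).
rewrite -[(r + s).+1]addnS -/(chain v s.+1).
rewrite [A 1 *m (A s.+1 *m v)]mulmxA dist_mx_mulS // mulmxDl mulmxDr -!scalemxAl -!scalemxAr.
rewrite pair -/(chain v s) => /eqP; rewrite -subr_eq => /eqP <-.
have -> : Es (r + s) *m (A 1 *m (Es (r + s).-1 *m (A s.+1 *m v))) =
    (c s * g s.-1) *: chain v s.
  case: s => [|s]; last first.
    rewrite addnS /= pair -/(chain v s) -!scalemxAr chain_raise.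
    by rewrite scalerA mulrC.
  rewrite addn0 (c_num0 Gamma_dr x) mul0r scale0r.
  case: (posnP r) => [->|r0]; first by rewrite Estar_dist_Estar.
  by rewrite low ?mulmx0 //; lia.
by rewrite scalerA -!scalerDl -scalerBl.
Qed.

Lemma dist_chain0 : A 1 *m chain v 0 = c 1 *: chain v 1.
Proof.
case: (vs) => v_r low pair.
rewrite (dist_split Gamma_dr bip (Estar_chain v 0)) chain_raise chain0 addn0.
case: (posnP r) => [r0|r0]; last by rewrite low ?addr0 //; lia.
by rewrite r0 in v_r *; rewrite -v_r Estar_dist_Estar // addr0.
Qed.

Lemma dist_chainS s :
  A 1 *m chain v s.+1 = c s.+2 *: chain v s.+2 + beta s *: chain v s.
Proof.
rewrite (dist_split Gamma_dr bip (Estar_chain v s.+1)) chain_raise.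
by rewrite addnS /= chain_lower.
Qed.

(** Raising and lowering are adjoint, so the two coefficients control the
    ratio of consecutive squared norms. *)
Lemma chain_norm s :
  c s.+1 * inner (chain v s.+1) (chain v s.+1) =
  Num.conj (beta s) * inner (chain v s) (chain v s).
Proof.
rewrite -innerZl -chain_raise -innerZr -chain_lower.
by rewrite -[(r + s).+1]addnS inner_Estar Estar_chain inner_dist // -inner_Estar Estar_chain.
Qed.

Definition chain_mod : {vspace V} := (\sum_(s < D.+1) <[chain v s]>)%VS.

Lemma chain_in s : chain v s \in chain_mod.
Proof.
have [sD|Ds] := ltnP s D.+1; last by rewrite chain_far ?mem0v //; lia.
by apply: (subvP (sumv_sup (Ordinal sD) _ _)) => //; apply: memv_line.
Qed.

Lemma chain_modP w :
  reflect (exists a, w = \sum_(s < D.+1) a s *: chain v s) (w \in chain_mod).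
Proof.
apply: (iffP memv_sumP) => [[ws Wws ->]|[a ->]].
  have /all_sig[a aP] (s : 'I_D.+1) : {k | ws s = k *: chain v s}.
    by apply/cid/vlineP/Wws.
  by exists a; apply: eq_bigr => s _; rewrite aP.
by exists (fun s : 'I_D.+1 => a s *: chain v s) => // s _; rewrite memvZ ?memv_line.
Qed.

Lemma seed_in_chain_mod : v \in chain_mod.
Proof. by rewrite -{1}chain0 chain_in. Qed.

Lemma chain_mod_T : T_module chain_mod.
Proof.
apply/T_moduleP; split=> [w|i w] /chain_modP[a ->].
  rewrite mulmx_sumr memv_suml // => s _; rewrite -scalemxAr memvZ //.
  case: s => -[|s] _ /=; first by rewrite dist_chain0 memvZ ?chain_in.
  by rewrite dist_chainS memvD ?memvZ ?chain_in.
rewrite mulmx_sumr memv_suml // => s _; rewrite -scalemxAr memvZ //.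
have [->|ne] := eqVneq i (r + s)%N; first by rewrite Estar_chain chain_in.
by rewrite Estar_chain_ne ?mem0v.
Qed.

Lemma Estar_chain_mod_sub s : (Estar_im (r + s) chain_mod <= <[chain v s]>)%VS.
Proof.
apply/subvP=> _ /Estar_imP[_ /chain_modP[a ->] ->].
rewrite mulmx_sumr memv_suml // => t _; rewrite -scalemxAr memvZ //.
have [->|ne] := eqVneq s (t : nat); first by rewrite Estar_chain memv_line.
by rewrite Estar_chain_ne ?mem0v ?eqn_add2l.
Qed.

Lemma Estar_chain_mod_low i w : (i < r)%N -> w \in chain_mod -> Es i *m w = 0.
Proof.
move=> ir /chain_modP[a ->]; rewrite mulmx_sumr big1 // => t _.
by rewrite -scalemxAr Estar_chain_ne ?scaler0 //; lia.
Qed.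

Lemma chain_mod_thin : thin e x chain_mod.
Proof.
move=> i _; have [ir|ri] := ltnP i r.
  rewrite leq_eqVlt; apply/orP; right; rewrite ltnS leqn0 dimv_eq0 -subv0.
  by apply/subvP=> _ /Estar_imP[w /(Estar_chain_mod_low ir) w0 ->]; rewrite w0 mem0v.
rewrite -(subnKC ri); apply: leq_trans (dimvS (Estar_chain_mod_sub _)) _.
by rewrite dim_vline leq_b1.
Qed.

Lemma chain_mod_sub (W : {vspace V}) : T_module W -> v \in W -> (chain_mod <= W)%VS.
Proof.
move=> /T_moduleP[WA WE] Wv; apply/subv_sumP=> s _; rewrite -memvE.
elim: (s : nat) => {s} [|s IHs]; first by rewrite chain0.
have [sD|Ds] := ltnP s D; last by rewrite chain_far ?mem0v //; lia.
by rewrite -(memv_scale _ _ (c_neq0 sD)) -chain_raise WE ?WA.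
Qed.

Hypothesis v0 : v != 0.

Lemma Estar_chain_mod : Estar_im r chain_mod = <[v]>%VS.
Proof.
apply/eqP; rewrite eqEsubv; apply/andP; split.
  by have := Estar_chain_mod_sub 0; rewrite addn0 chain0.
rewrite -memvE; apply/Estar_imP; exists v; first exact: seed_in_chain_mod.
by case: vs.
Qed.

Lemma chain_mod_endpoint : endpoint chain_mod = r.
Proof.
apply: endpoint_unique => [||i ir w]; last exact: Estar_chain_mod_low.
  rewrite leqNgt; apply: contra v0 => Dr; case: vs => <- _ _.
  by rewrite Estar_far.
by rewrite Estar_chain_mod -dimv_eq0 dim_vline v0.
Qed.

(** A submodule either contains a vector with a nonzero component on the sphere
    of radius [r], hence contains [v], or is orthogonal to [v]; in the second case
    it is orthogonal to the whole chain, since lowering is adjoint to raising. *)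
Lemma chain_mod_irr : T_irreducible chain_mod.
Proof.
split; first exact: chain_mod_T.
  by apply: contraNneq v0 => W0; rewrite -memv0 -W0 seed_in_chain_mod.
move=> W' W'mod sW'; have /T_moduleP[W'A W'E] := W'mod.
have [W'r|/eqP W'r] := eqVneq (Estar_im r W') 0%VS; [left|right]; last first.
  apply/eqP; rewrite eqEsubv sW' /= chain_mod_sub //.
  have [u /Estar_imP[w W'w uE] u0] : exists2 u, u \in Estar_im r W' & u != 0.
    by exists (vpick (Estar_im r W')); rewrite ?memv_pick ?vpick0; apply/eqP.
  have : u \in <[v]>%VS.
    by rewrite -Estar_chain_mod (subvP (limgS _ sW')) //; apply/Estar_imP; exists w.
  case/vlineP=> k uk; have k0 : k != 0 by apply: contraNneq u0 => k0; rewrite uk k0 scale0r.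
  by rewrite -(memv_scale _ _ k0) -uk uE W'E.
have orth s w : w \in W' -> inner w (chain v s) = 0.
  elim: s w => [|s IHs] w W'w.
    rewrite -Estar_chain addn0 -inner_Estar //.
    suff -> : Es r *m w = 0 by rewrite inner0l.
    by apply/eqP; rewrite -memv0 -W'r; apply/Estar_imP; exists w.
  have [sD|Ds] := ltnP s D; last by rewrite chain_far ?inner0r //; lia.
  have cs : Num.conj (c s.+1 : K) != 0 by rewrite rmorph_nat c_neq0.
  apply: (mulfI cs); rewrite mulr0 -innerZr -chain_raise -inner_Estar //.
  by rewrite -inner_dist // IHs ?W'A ?W'E.
apply/eqP; rewrite -subv0; apply/subvP=> w W'w; rewrite memv0 -inner_eq0.
have /chain_modP[a wE] := subvP sW' _ W'w.
by rewrite {2}wE inner_sumr big1 // => s _; rewrite innerZr orth ?mulr0.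
Qed.

Lemma chain_mod_unique (W : {vspace V}) : T_irreducible W -> v \in W -> W = chain_mod.
Proof.
move=> [Wmod W0 Wirr] Wv; have sub := chain_mod_sub Wmod Wv.
have [C0|//] := Wirr _ chain_mod_T sub.
by have := seed_in_chain_mod; rewrite C0 memv0 (negPf v0).
Qed.

End OneSeed.

(** The map sending one chain to the other is a module isomorphism because the
    coefficients [c] and [beta] only involve the graph and [g]; the norm formula
    shows that the two chains vanish at the same places. *)
Lemma chain_mod_iso v v' : seed v -> seed v' -> v != 0 -> v' != 0 ->
  T_isomorphic e x (chain_mod v) (chain_mod v').
Proof.
move=> vs vs' v0 v'0.
have norm0 u : (inner u u == 0) = (u == 0 :> V) := inner_eq0 u.
have ratio s : inner (chain v s) (chain v s) * inner v' v' =
               inner (chain v' s) (chain v' s) * inner v v.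
  elim: s => [|s IHs]; first by rewrite !chain0 // mulrC.
  have [sD|Ds] := ltnP s D; last by rewrite !chain_far ?inner0r ?mul0r //; lia.
  apply: (mulfI (c_neq0 sD)); rewrite !mulrA !chain_norm // -!mulrA.
  by rewrite IHs.
have zero s : (chain v s == 0) = (chain v' s == 0).
  rewrite -!norm0; apply/eqP/eqP=> n0; have := ratio s; rewrite n0 mul0r => /esym/eqP.
    by rewrite mulf_eq0 [inner v v == 0]norm0 (negPf v0) orbF => /eqP.
  by rewrite eq_sym mulf_eq0 [inner v' v' == 0]norm0 (negPf v'0) orbF => /eqP.
(* The orthogonal projection onto the first chain, followed by the transport to
   the second one; vanishing terms of the chain contribute nothing. *)
pose S : 'M[K]_#|X| := \sum_(s < D.+1)
  (inner (chain v s) (chain v s))^-1 *: (chain v' s *m (map_mx Num.conj (chain v s))^T).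
have SE w : S *m w = \sum_(s < D.+1)
    ((inner (chain v s) (chain v s))^-1 * inner w (chain v s)) *: chain v' s.
  rewrite mulmx_suml; apply: eq_bigr => s _; rewrite -scalemxAl -scalerA -mulmxA.
  congr (_ *: _); rewrite [X in _ *m X]mx11_scalar mul_mx_scalar; congr (_ *: _).
  by rewrite /inner -[in LHS](trmxK w) -trmx_mul mxE.
have orth s t : s != t -> inner (chain v s) (chain v t) = 0.
  by move=> st; rewrite -Estar_chain inner_Estar // Estar_chain_ne ?inner0r ?eqn_add2l.
have Schain s : S *m chain v s = chain v' s.
  have [sD|Ds] := ltnP s D.+1; last by rewrite !chain_far ?mulmx0 //; lia.
  rewrite SE (bigD1 (Ordinal sD)) //= big1 ?addr0 => [|t]; last first.
    move=> tO; have st : s != t by apply: contraNneq tO => st; apply/eqP/val_inj.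
    by rewrite (orth _ _ st) mulr0 scale0r.
  have [c0|c0] := eqVneq (chain v s) 0; last by rewrite mulVf ?scale1r ?norm0.
  by move: (zero s); rewrite c0 eqxx => /esym/eqP ->; rewrite scaler0.
have Smod a : S *m (\sum_(s < D.+1) a s *: chain v s) = \sum_(s < D.+1) a s *: chain v' s.
  by rewrite mulmx_sumr; apply: eq_bigr => s _; rewrite -scalemxAr Schain.
exists (mxact S); split.
- move=> w w' /chain_modP[a ->] /chain_modP[a' ->]; rewrite !mxactE !Smod => eq_a.
  apply: eq_bigr => s _; have := congr1 (mulmx (Es (r + s))) eq_a.
  have pick (a1 : 'I_D.+1 -> K) : Es (r + s) *m (\sum_(s < D.+1) a1 s *: chain v' s)
     = a1 s *: chain v' s.
    rewrite mulmx_sumr (bigD1 s) //= big1 ?addr0 => [|t ts].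
      by rewrite -scalemxAr Estar_chain.
    by rewrite -scalemxAr Estar_chain_ne ?scaler0 // eqn_add2l eq_sym.
  rewrite !pick; have [c0 _|c0] := eqVneq (chain v s) 0; first by rewrite c0 !scaler0.
  move/eqP; rewrite -subr_eq0 -scalerBl scaler_eq0 -zero (negPf c0) orbF subr_eq0.
  by move/eqP->.
- apply/vspaceP=> w; apply/memv_imgP/chain_modP=> [[_ /chain_modP[a ->] ->]|[a ->]].
    by exists a; rewrite mxactE Smod.
  by exists (\sum_(s < D.+1) a s *: chain v s); [apply/chain_modP; exists a | rewrite mxactE Smod].
have stable B w : in_T e x B -> w \in chain_mod v -> B *m w \in chain_mod v.
  by move=> TB Ww; rewrite -mxactE (subvP (chain_mod_T vs TB)) // memv_img.
suff comm B : in_T e x B -> {in chain_mod v, forall w, S *m (B *m w) = B *m (S *m w)}.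
  by move=> B TB w Ww; rewrite !mxactE comm.
elim=> [|i _|a C _ IHC|C C' TC IHC TC' IHC'|C C' TC IHC TC' IHC'] w Ww.
- case/chain_modP: Ww => a ->; rewrite Smod !mulmx_sumr; apply: eq_bigr => s _.
  rewrite -!scalemxAr; congr (_ *: _); case: s => -[|s] _ /=.
    by rewrite !dist_chain0 // -scalemxAr Schain.
  by rewrite !dist_chainS // mulmxDr -!scalemxAr !Schain.
- case/chain_modP: Ww => a ->; rewrite Smod !mulmx_sumr; apply: eq_bigr => s _.
  rewrite -!scalemxAr; congr (_ *: _); have [->|ne] := eqVneq i (r + s)%N.
    by rewrite !Estar_chain Schain.
  by rewrite !Estar_chain_ne // mulmx0.
- by rewrite -!scalemxAl -scalemxAr IHC.
- by rewrite !mulmxDl mulmxDr IHC ?IHC'.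
- by rewrite -!mulmxA IHC ?IHC' ?stable.
Qed.

End Chain.

End Modules.

(** * Positivity read off from the eigenvalues *)

Section Spectral.
Variables (K : numClosedFieldType) (X : finType).
Local Notation V := 'cV[K]_#|X|.

Lemma real_symmetric_spectral n (B : 'M[K]_n) :
  B^T = B -> map_mx Num.conj B = B ->
  [/\ spectralmx B *m B = diag_mx (spectral_diag B) *m spectralmx B,
      forall i, spectral_diag B 0 i \is Num.real &
      forall i, eigenvalue B (spectral_diag B 0 i)].
Proof.
move=> Bt Bc.
have Bherm : B \is hermsymmx.
  by apply/is_hermitianmxP; rewrite expr0 scale1r Bt Bc.
have Bsp := (orthomx_spectralP (hermitian_normalmx Bherm)).
have PB : spectralmx B *m B = diag_mx (spectral_diag B) *m spectralmx B.
  by rewrite {2}Bsp !mulmxA mulmxV ?mul1mx ?spectral_unit.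
split=> // i; first by have /mxOverP/(_ 0 i) := hermitian_spectral_diag_real Bherm.
apply/eigenvalueP; exists (row i (spectralmx B)).
  by apply/rowP=> j; rewrite -row_mul PB mxE mul_diag_mx !mxE.
apply/negP=> /eqP Pi0; have := row_free_unit (spectralmx B).
rewrite spectral_unit => /row_freeP[Q PQ]; have := congr1 (row i) PQ.
rewrite row_mul Pi0 mul0mx => /rowP/(_ i); rewrite !mxE eqxx => /esym/eqP.
by rewrite oner_eq0.
Qed.

(** In an orthonormal eigenbasis the form is a sum of squares with the weights
    [(a - l) * (b - l)]. *)
Lemma inner_two_factors_ge0 (B : 'M[K]_#|X|) (a b : K) (u : V) :
  B^T = B -> map_mx Num.conj B = B -> b \is Num.real ->
  (forall l, eigenvalue B l -> 0 <= (a - l) * (b - l)) ->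
  0 <= inner (a *: u - B *m u) (b *: u - B *m u).
Proof.
move=> Bt Bc b_re pos; have [PB d_re d_eig] := real_symmetric_spectral Bt Bc.
set P := spectralmx B in PB; set dg := spectral_diag B in PB d_re d_eig.
have Pu : P^T *m map_mx Num.conj P = 1%:M.
  have /unitarymxP/mulmx1C := spectral_unitarymx B.
  by move/(congr1 (map_mx Num.conj)); rewrite map_mxM map_mx1 map_mxCK.
have isom y z : inner (P *m y) (P *m z) = inner y z.
  by rewrite /inner trmx_mul map_mxM -mulmxA [P^T *m _]mulmxA Pu mul1mx.
have fac t : P *m (t *: u - B *m u) = \col_i ((t - dg 0 i) * (P *m u) i 0).
  rewrite mulmxBr -scalemxAr mulmxA PB -mulmxA; apply/colP=> i.
  by rewrite mul_diag_mx !mxE mulrBl.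
rewrite -isom !fac innerE sumr_ge0 // => i _; rewrite ![in X in _ <= X]mxE rmorphM /=.
set w := \sum_j _; rewrite (CrealP _); last by rewrite rpredB.
by rewrite mulrACA mulr_ge0 ?pos // mul_conjC_ge0.
Qed.

End Spectral.

(** * Eigensequences *)

Section Cosines.
Variables (K : numClosedFieldType) (X : finType) (e : rel X) (x : X).
Hypothesis Gamma_dr : distance_regular e.
Hypothesis bip : bipartite e.

Local Notation V := 'cV[K]_#|X|.
Local Notation d := (gdist e).
Local Notation D := (diameter e).
Local Notation A := (dist_mx K e).
Local Notation Es := (Estar K e x).
Local Notation b i := (b_num e i)%:R.
Local Notation c i := (c_num e i)%:R.

Let conn : simple_connected_graph e. Proof. by case: Gamma_dr. Qed.

Lemma level_nonempty (y : X) m : (m <= D)%N -> exists z, d y z = m.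
Proof.
move=> /(gdist_onto conn y)[u [v uv]].
have := inter_num_gt0 Gamma_dr u v u; rewrite (gdist_sym conn v u) gdistxx // uv.
have := num_betweenE Gamma_dr m m y y; rewrite gdistxx // => <-.
rewrite card_gt0 => /set0Pn[z].
by rewrite inE => /andP[/eqP]; exists z.
Qed.

Definition radial (y : X) (f : nat -> K) : V := \col_r f (d y (enum_val r)).

Lemma dist_radial y f :
  A 1 *m radial y f = radial y (fun j => c j * f j.-1 + b j * f j.+1).
Proof.
apply/colP=> r; rewrite !mxE; set h := d y _.
have rh : d (enum_val r) y = h by rewrite gdist_sym.
have -> : c h = (num_between e 1 h.-1 (enum_val r) y)%:R :> K by rewrite num_betweenE // rh.
have -> : b h = (num_between e 1 h.+1 (enum_val r) y)%:R :> K by rewrite num_betweenE // rh.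
rewrite !num_between_sum !mulr_suml -big_split /= -[RHS]big_enum_val_all.
apply: eq_bigr => w _.
rewrite !mxE; case: (d (enum_val r) (enum_val w) =P 1%N) => [rw|] /=; last first.
  by rewrite !mul0r addr0.
have := gdist_nbr Gamma_dr bip y rw; rewrite rh (gdist_sym conn y).
case: eqP => [->|_] /=.
  by rewrite (_ : _ == h.-1 = false) ?mul0r ?add0r //; lia.
by case/andP=> /eqP -> _; rewrite eqxx mul0r addr0.
Qed.

(** The coefficients of an eigenvector that is constant on the spheres around a
    vertex. *)
Definition eigenseq (t : K) (f : nat -> K) : Prop :=
  forall j, (j <= D)%N -> c j * f j.-1 + b j * f j.+1 = t * f j.

Lemma eigenseq_radial t f y : eigenseq t f -> A 1 *m radial y f = t *: radial y f.
Proof.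
move=> tf; rewrite dist_radial; apply/colP=> r; rewrite !mxE tf //.
exact: gdist_diameter.
Qed.

Lemma eigenseq_zero t f j : eigenseq t f -> (j.+1 <= D)%N ->
  f j = 0 -> f j.+1 = 0 -> f 0 = 0.
Proof.
move=> tf; elim: j => // j IHj jD fj1 fj2; apply: IHj => //; first exact: ltnW.
have := tf j.+1 (ltnW jD); rewrite /= fj1 fj2 !mulr0 addr0 => /eqP.
by rewrite mulf_eq0 (negPf (c_neq0 K x Gamma_dr (ltnW jD))) => /eqP.
Qed.

Lemma eigenseq_eigenvalue t f : eigenseq t f -> f 0 != 0 -> eigenvalue (A 1) t.
Proof.
move=> tf f0; apply/eigenvalueP; exists (radial x f)^T.
  apply: trmx_inj; rewrite trmx_mul trmxK dist_mx_tr // (eigenseq_radial _ tf).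
  by rewrite linearZ /= trmxK.
rewrite trmx_eq0; apply: contraNneq f0 => /colP/(_ (enum_rank x)).
by rewrite !mxE enum_rankK gdistxx // => ->.
Qed.

Lemma eigenseq_const : eigenseq (valency e)%:R (fun _ => 1).
Proof.
move=> j jD; rewrite !mulr1 -natrD addnC.
by rewrite (bc_valency Gamma_dr x bip).
Qed.

Lemma eigenseq_alt t u : eigenseq t u -> eigenseq (- t) (fun j => (-1) ^+ j * u j).
Proof.
move=> tu j jD; transitivity (- (-1) ^+ j * (c j * u j.-1 + b j * u j.+1)).
  case: j jD => [|j] jD; rewrite ?(c_num0 Gamma_dr x) !exprS; ring.
by rewrite tu //; ring.
Qed.

(** Glue an eigensequence for [t] below level [m] to one for [t'] above it.  If
    [f] is the resulting vector, then [(t - A 1) *m f] vanishes below level [m]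
    and [(t' - A 1) *m f] above it, so their inner product is a single term. *)
Lemma glued_eigenseq_ge0 t t' u g m :
  eigenseq t u -> eigenseq t' g -> t' \is Num.real ->
  (forall j, u j \is Num.real) -> (forall j, g j \is Num.real) ->
  (forall l, eigenvalue (A 1) l -> 0 <= (t - l) * (t' - l)) ->
  (0 < m < D)%N ->
  0 <= (g m * u m.+1 - u m * g m.+1) * (u m * g m.-1 - g m * u m.-1).
Proof.
move=> tu tg t'_re u_re g_re pos /andP[m0 mD].
(* The factors [g m] and [u m] make the two halves agree at level [m]. *)
pose f j := if (j <= m)%N then g m * u j else u m * g j.
have fE1 j : (j <= m)%N -> f j = g m * u j by rewrite /f => ->.
have fE2 j : (m <= j)%N -> f j = u m * g j.
  by rewrite /f; case: ltngtP => // -> _; rewrite mulrC.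
have := inner_two_factors_ge0 (radial x f) (dist_mx_tr K Gamma_dr 1)
          (dist_mx_conj K e 1) t'_re pos.
rewrite innerE dist_radial.
set P := (_ * _ in X in _ -> X).
have bm0 : 0 < b m :> K by rewrite ltr0n (b_num_gt0 Gamma_dr x).
have cm0 : 0 < c m :> K by rewrite ltr0n (c_num_gt0 Gamma_dr x) // m0 ltnW.
have term r : (t *: radial x f - radial x (fun j => c j * f j.-1 + b j * f j.+1)) r 0 *
   Num.conj ((t' *: radial x f - radial x (fun j => c j * f j.-1 + b j * f j.+1)) r 0)
   = (d x (enum_val r) == m)%:R * (b m * c m * P).
  rewrite !mxE; have := gdist_diameter e x (enum_val r).
  move: (d x _) => j jD; case: (ltngtP j m) => jm.
  - rewrite !fE1 //; try lia.
    rewrite (_ : t * _ - _ = g m * (t * u j - (c j * u j.-1 + b j * u j.+1))); last by ring.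
    by rewrite tu // subrr mulr0 !mul0r.
  - rewrite !fE2 //; try lia.
    rewrite (_ : t' * _ - _ = u m * (t' * g j - (c j * g j.-1 + b j * g j.+1))); last by ring.
    by rewrite tg // subrr mulr0 rmorph0 mulr0 mul0r.
  - rewrite {}jm mul1r (fE2 m.+1) // (fE1 m.-1) ?leq_pred // (fE1 m) //.
    have Eu := tu _ (ltnW mD); have Eg := tg _ (ltnW mD).
    rewrite (_ : t * _ - _ = b m * (g m * u m.+1 - u m * g m.+1)); last first.
      by rewrite mulrCA -Eu; ring.
    rewrite (_ : t' * _ - _ = c m * (u m * g m.-1 - g m * u m.-1)); last first.
      by rewrite [g m * _]mulrC mulrCA -Eg; ring.
    rewrite (CrealP _) /P; first by ring.
    by rewrite !(rpredM, rpredB, realn).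
rewrite (eq_bigr _ (fun r _ => term r)) -mulr_suml => pos'.
have [z xz] := level_nonempty x (ltnW mD).
have k0 : 0 < \sum_(r < #|X|) (d x (enum_val r) == m)%:R :> K.
  rewrite (big_enum_val_all (fun y => (d x y == m)%:R : K)) (bigD1 z) //= xz eqxx.
  by rewrite ltr_wpDr ?sumr_ge0.
by move: pos'; rewrite pmulr_rge0 // pmulr_rge0 // mulr_gt0.
Qed.

(** Gluing with the constant sequence, which belongs to the valency, shows that
    consecutive differences of [u] do not change sign.  If [u m.-1 = u m.+1] they
    both vanish, and an eigensequence constant on three levels is zero. *)
Lemma eigenseq_neq_top t u m :
  eigenseq t u -> u 0 = 1 -> (forall j, u j \is Num.real) ->
  t != (valency e)%:R ->
  (forall l, eigenvalue (A 1) l -> 0 <= (t - l) * ((valency e)%:R - l)) ->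
  (0 < m < D)%N -> u m.-1 != u m.+1.
Proof.
move=> tu u0 u_re tk pos /andP[m0 mD]; apply/eqP=> eq_u.
have := glued_eigenseq_ge0 tu eigenseq_const (realn _ _) u_re (fun _ => real1 _) pos _.
move=> /(_ m); rewrite m0 mD !mul1r !mulr1 eq_u => /(_ isT).
rewrite -[X in 0 <= _ * X]opprB mulrN oppr_ge0 -expr2 => sq_le0.
have um : u m.+1 = u m.
  apply/eqP; rewrite -subr_eq0 -sqrf_eq0 eq_le sq_le0 /=.
  by rewrite -realEsqr rpredB.
have := tu m (ltnW mD); rewrite eq_u um -mulrDl -natrD addnC.
rewrite (bc_valency Gamma_dr x bip) ?(ltnW mD) // => /eqP.
rewrite eq_sym -subr_eq0 -mulrBl mulf_eq0 subr_eq0 (negPf tk) => /eqP um0.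
have := eigenseq_zero tu mD um0; rewrite um => /(_ um0)/eqP.
by rewrite u0 oner_eq0.
Qed.

(** Gluing with the alternating sequence, which belongs to [- t], shows that
    [u m.-1] and [u m.+1] have opposite signs.  If they are equal they vanish, and
    then [u] has two consecutive zeros. *)
Lemma eigenseq_neq_mid t u m :
  eigenseq t u -> u 0 = 1 -> (forall j, u j \is Num.real) ->
  t != 0 -> t \is Num.real ->
  (forall l, eigenvalue (A 1) l -> 0 <= (t - l) * (- t - l)) ->
  (0 < m < D)%N -> u m.-1 != u m.+1.
Proof.
move=> tu u0 u_re t0 t_re pos /andP[m0 mD]; apply/eqP=> eq_u.
have alt := eigenseq_alt tu.
have alt_re j : (-1) ^+ j * u j \is Num.real by rewrite rpredM // rpredX // rpredN rpred1.
have tN_re : - t \is Num.real by rewrite rpredN.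
have := glued_eigenseq_ge0 tu alt tN_re u_re alt_re pos.
move=> /(_ m); rewrite m0 mD => /(_ isT).
case: m m0 mD eq_u => // m _ mD /= eq_u; rewrite eq_u !exprS.
set s := (-1) ^+ m; have s2 : s * s = 1 by rewrite -expr2 sqrr_sign.
rewrite [X in 0 <= X -> _](_ : _ = - ((2 * (u m.+1 * u m.+2)) ^+ 2)); last first.
  by transitivity (- (s * s) * (2 * (u m.+1 * u m.+2)) ^+ 2); [ring | rewrite s2; ring].
rewrite oppr_ge0 => sq_le0.
have : u m.+1 * u m.+2 == 0.
  have : 2 * (u m.+1 * u m.+2) == 0.
    by rewrite -sqrf_eq0 eq_le sq_le0 /= -realEsqr !rpredM ?realn.
  by rewrite mulf_eq0 pnatr_eq0.
have Eu := tu m.+1 (ltnW mD); rewrite /= eq_u -mulrDl -natrD addnC in Eu.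
rewrite (bc_valency Gamma_dr x bip) ?(ltnW mD) // in Eu.
have k0 : (valency e)%:R != 0 :> K.
  rewrite pnatr_eq0 -lt0n -(bc_valency Gamma_dr x bip (ltnW mD)) addn_gt0.
  by rewrite (b_num_gt0 Gamma_dr x).
have um0 : u m.+1 * u m.+2 == 0 -> u m.+1 = 0.
  rewrite mulf_eq0 => /orP[/eqP //|/eqP u20]; move/eqP: Eu.
  by rewrite u20 mulr0 eq_sym mulf_eq0 (negPf t0) => /eqP.
move=> /um0 um1; have um2 : u m.+2 = 0.
  by move/eqP: Eu; rewrite um1 mulr0 mulf_eq0 (negPf k0) => /eqP.
have := eigenseq_zero tu mD um1 um2; rewrite u0 => /eqP.
by rewrite oner_eq0.
Qed.

Lemma sum_dist1 r : \sum_s A 1 r s = (valency e)%:R.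
Proof.
have /colP/(_ r) := eigenseq_radial x eigenseq_const.
rewrite !mxE mulr1 => <-; apply: eq_bigr => s _.
by rewrite [radial _ _ _ _]mxE mulr1.
Qed.

(** The Laplacian [valency - A 1] is positive semidefinite, being a sum of
    squares over the edges. *)
Lemma eigenvalue_le_valency l : eigenvalue (A 1) l -> l \is Num.real ->
  l <= (valency e)%:R.
Proof.
move=> /eigenvalueP[wt wl w0] l_re.
have [w wA {w0} w0] : exists2 w : V, A 1 *m w = l *: w & w != 0.
  by exists wt^T; rewrite ?trmx_eq0 // -[in RHS]linearZ /= -wl trmx_mul dist_mx_tr.
have wpos : 0 < inner w w by rewrite lt_def inner_eq0 w0 inner_ge0.
have e1 : \sum_r \sum_s A 1 r s * (w r 0 * (w r 0)^*) = (valency e)%:R * inner w w.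
  rewrite innerE mulr_sumr; apply: eq_bigr => r _.
  by rewrite -mulr_suml sum_dist1.
have A_sym r s : A 1 r s = A 1 s r by rewrite -{1}(dist_mx_tr K Gamma_dr 1) mxE.
have e2 : \sum_r \sum_s A 1 r s * (w s 0 * (w s 0)^*) = (valency e)%:R * inner w w.
  rewrite exchange_big -e1; apply: eq_bigr => r _; apply: eq_bigr => s _.
  by rewrite A_sym.
have e3 : \sum_r \sum_s A 1 r s * (w s 0 * (w r 0)^*) = l * inner w w.
  rewrite -innerZl -wA innerE; apply: eq_bigr => r _; rewrite [(_ *m w) r 0]mxE mulr_suml.
  by apply: eq_bigr => s _; rewrite mulrA.
have e4 : \sum_r \sum_s A 1 r s * (w r 0 * (w s 0)^*) = l * inner w w.
  rewrite exchange_big -e3; apply: eq_bigr => r _; apply: eq_bigr => s _.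
  by rewrite A_sym.
have : 0 <= \sum_r \sum_s A 1 r s * ((w r 0 - w s 0) * (w r 0 - w s 0)^*).
  apply: sumr_ge0 => r _; apply: sumr_ge0 => s _.
  by rewrite mulr_ge0 ?mul_conjC_ge0 // mxE ler0n.
have -> : \sum_r \sum_s A 1 r s * ((w r 0 - w s 0) * (w r 0 - w s 0)^*) =
    2 * (((valency e)%:R - l) * inner w w).
  transitivity ((valency e)%:R * inner w w + (valency e)%:R * inner w w -
                l * inner w w - l * inner w w); last by ring.
  rewrite -{1}e1 -e2 -{1}e3 -e4 -big_split -!sumrB /=; apply: eq_bigr => r _.
  rewrite -big_split -!sumrB /=; apply: eq_bigr => s _.
  by rewrite rmorphB /=; ring.
by rewrite pmulr_rge0 ?ltr0n // pmulr_lge0 // subr_ge0.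
Qed.

End Cosines.

(** * Cosine sequences and projections onto eigenspaces *)

Section CosineSequence.
Variables (K : numClosedFieldType) (X : finType) (e : rel X) (x : X).
Hypothesis Gamma_dr : distance_regular e.
Hypothesis bip : bipartite e.
Hypothesis D_gt0 : (0 < diameter e)%N.

Local Notation V := 'cV[K]_#|X|.
Local Notation d := (gdist e).
Local Notation D := (diameter e).
Local Notation A := (dist_mx K e).
Local Notation Es := (Estar K e x).
Local Notation b i := (b_num e i)%:R.
Local Notation c i := (c_num e i)%:R.
Local Notation k i := (num_between e i i x x)%:R.

Let conn : simple_connected_graph e. Proof. by case: Gamma_dr. Qed.

Variable t : K.

(** Two consecutive values of the solution of the recurrence of [eigenseq]. *)
Fixpoint cosine_pair j : K * K :=
  if j is i.+1 then
    let: (p, q) := cosine_pair i in (q, (t * q - c i * p) / b i)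
  else (0, 1).

Definition cosine j : K := (cosine_pair j).2.

Lemma cosineS j : (j < D)%N ->
  c j * cosine j.-1 + b j * cosine j.+1 = t * cosine j.
Proof.
move=> jD; have b0 : b j != 0 :> K by rewrite pnatr_eq0 -lt0n (b_num_gt0 Gamma_dr x).
have p1 : c j * (cosine_pair j).1 = c j * cosine j.-1.
  case: j {jD b0} => [|j]; first by rewrite (c_num0 Gamma_dr x) !mul0r.
  by rewrite /cosine /=; case: (cosine_pair j).
rewrite -p1 /cosine /=; case: (cosine_pair j) {p1} => p q /=.
by rewrite mulrCA divff // mulr1 addrC subrK.
Qed.

Lemma cosine_real j : t \is Num.real -> cosine j \is Num.real.
Proof.
move=> t_re.
suff : ((cosine_pair j).1 \is Num.real) && ((cosine_pair j).2 \is Num.real) by case/andP.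
elim: j => [|j] /=; first by rewrite real0 real1.
case: (cosine_pair j) => p q /= /andP[p_re q_re]; rewrite q_re /=.
by rewrite rpredM ?rpredV ?rpredB ?rpredM ?realn.
Qed.

(** Both sides count the edges between two consecutive spheres, here as an entry
    of [A j.+1 *m A 1 *m A j]. *)
Lemma kb_eq_kc j : (j < D)%N -> k j * b j = k j.+1 * c j.+1 :> K.
Proof.
move=> jD; pose r := enum_rank x.
have entry i h : (A i *m A h) r r = if i == h then k i else 0.
  rewrite dist_mx_mul mxE enum_rankK num_between_sum.
  case: eqP => [<-|ih]; first by rewrite num_between_sum.
  rewrite big1 // => y _; rewrite (gdist_sym conn y x).
  by case: eqP => //= ->; case: eqP.
have A1A : A j.+1 *m A 1 = c j.+2 *: A j.+2 + b j *: A j.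
  apply: trmx_inj; rewrite trmx_mul (dist_mx_tr K Gamma_dr 1) (dist_mx_tr K Gamma_dr j.+1).
  rewrite dist_mx_mulS // linearD /=.
  by rewrite !linearZ /= !dist_mx_tr.
have : (A j.+1 *m (A 1 *m A j)) r r = (A j.+1 *m A 1 *m A j) r r by rewrite mulmxA.
rewrite A1A mulmxDl -!scalemxAl.
have lin (a a' : K) (M N : 'M_#|X|) : (a *: M + a' *: N) r r = a * M r r + a' * N r r.
  by rewrite !mxE.
rewrite lin !entry eqxx.
rewrite (_ : (j.+2 == j) = false); last by lia.
rewrite mulr0 add0r mulrC => <-.
case: j {jD A1A} => [|j].
  by rewrite (dist_mx_mul1 K x) // -scalemxAr mxE entry eqxx mulrC.
rewrite dist_mx_mulS // mulmxDr -!scalemxAr lin !entry eqxx.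
by rewrite (_ : (j.+2 == j) = false) ?mulr0 ?addr0 1?mulrC //; lia.
Qed.

(** An eigenvector of [A 1] is one of every distance matrix, since these are
    polynomials in [A 1]; the recursion of the eigenvalues is the one of
    [cosine] rescaled by the sizes of the spheres. *)
Lemma dist_mx_eigen m (w : 'M[K]_(#|X|, m)) j : A 1 *m w = t *: w -> (j <= D)%N ->
  A j *m w = (k j * cosine j) *: w.
Proof.
move=> tw; elim/ltn_ind: j => -[_ _|j IHj jD].
  rewrite dist_mx0 // mul1mx (_ : num_between e 0 0 x x = 1%N) ?mul1r ?scale1r //.
  rewrite -[RHS](cards1 x); apply: eq_card => y; rewrite !inE (gdist_sym conn y x).
  by rewrite (gdist_eq0 conn) andbb eq_sym.
have c0 := c_neq0 K x Gamma_dr jD.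
have step : A 1 *m (A j *m w) = (k j * (t * cosine j)) *: w.
  by rewrite IHj ?(ltnW jD) // -scalemxAr tw scalerA mulrAC mulrA.
apply: (scalerI c0); rewrite scalerA mulrA [c _ * _]mulrC -kb_eq_kc // -mulrA.
have Ej : b j * cosine j.+1 = t * cosine j - c j * cosine j.-1.
  by rewrite -cosineS // addrC addKr.
rewrite {}Ej; case: j IHj jD c0 step => [|j] IHj jD c0.
  rewrite mulmxA (dist_mx_mul1 K x) // -scalemxAl => ->.
  by rewrite (c_num0 Gamma_dr x) mul0r subr0.
rewrite mulmxA dist_mx_mulS // mulmxDl -!scalemxAl [A j *m w]IHj ?(ltnW (ltnW jD)) //.
move/eqP; rewrite eq_sym -subr_eq => /eqP <-; rewrite scalerA -scalerBl /=.
rewrite mulrBr [k _ * (c _ * _)]mulrA -(kb_eq_kc (ltnW jD)).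
by congr (_ *: w); ring.
Qed.

(** Below level [D] the recurrence defines [cosine]; at level [D] it is a
    condition on [t], obtained by applying [A 1 *m A D] to an eigenvector. *)
Lemma cosine_eigenseq : eigenvalue (A 1) t -> eigenseq e t cosine.
Proof.
move=> /eigenvalueP[w wt w0] j; rewrite leq_eqVlt => /predU1P[->|]; last exact: cosineS.
rewrite b_num_far // mul0r addr0.
have wt' : A 1 *m w^T = t *: w^T by rewrite -[in RHS]linearZ /= -wt trmx_mul dist_mx_tr.
have [i Di] : exists i, D = i.+1 by exists D.-1; rewrite prednK.
have iD : (i < D)%N by rewrite Di.
have k0 : k D != 0 :> K.
  have [y xy] := level_nonempty Gamma_dr x (leqnn D).
  rewrite pnatr_eq0 -lt0n card_gt0; apply/set0Pn; exists y.
  by rewrite inE (gdist_sym conn y x) xy eqxx.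
have : A 1 *m (A D *m w^T) = b i *: (A i *m w^T).
  rewrite mulmxA [in A D]Di dist_mx_mulS // -Di dist_mx_far // scaler0 add0r.
  by rewrite scalemxAl.
rewrite (dist_mx_eigen wt' (leqnn D)) (dist_mx_eigen wt' (ltnW iD)) -scalemxAr wt' !scalerA => /eqP.
rewrite -subr_eq0 -scalerBl scaler_eq0 trmx_eq0 (negPf w0) orbF subr_eq0 => /eqP E.
apply: (mulfI k0); rewrite mulrA [k D * (t * _)]mulrCA [t * _]mulrC E mulrA.
by rewrite [b i * _]mulrC kb_eq_kc // Di.
Qed.

(** For an eigenvalue [t] this is, up to a positive factor, the projection onto
    the eigenspace of [t]. *)
Definition eigenproj : 'M[K]_#|X| := \matrix_(r, s) cosine (d (enum_val r) (enum_val s)).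

Lemma eigenprojE : eigenproj = \sum_(j < D.+1) cosine j *: A j.
Proof.
apply/matrixP=> r s; rewrite summxE mxE.
have lt_rs : (d (enum_val r) (enum_val s) < D.+1)%N by rewrite ltnS gdist_diameter.
rewrite (bigD1 (Ordinal lt_rs)) //= !mxE eqxx mulr1 big1 ?addr0 // => j.
by rewrite !mxE -val_eqE /= eq_sym => /negPf->; rewrite mulr0.
Qed.

Lemma dist_eigenproj : eigenvalue (A 1) t -> A 1 *m eigenproj = t *: eigenproj.
Proof.
move=> /cosine_eigenseq tu; apply/matrixP=> r s.
have := eigenseq_radial Gamma_dr bip (enum_val s) tu.
move/colP/(_ r); rewrite !mxE (gdist_sym conn (enum_val s)) => <-.
by apply: eq_bigr => w _; rewrite !mxE (gdist_sym conn (enum_val s)).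
Qed.

(** The matrix [eigenproj] is symmetric and its square is a multiple of it, so
    the squared norm of [eigenproj *m v] is a multiple of the inner product in
    the hypothesis. *)
Lemma eigenproj_kernel (v : V) : eigenvalue (A 1) t -> t \is Num.real ->
  inner (eigenproj *m v) v = 0 -> eigenproj *m v = 0.
Proof.
move=> t_eig t_re Fvv; apply/eqP; rewrite -inner_eq0.
have Ft : eigenproj^T = eigenproj by apply/matrixP=> r s; rewrite !mxE gdist_sym.
have Fc : map_mx Num.conj eigenproj = eigenproj.
  by apply/matrixP=> r s; rewrite !mxE; apply/CrealP/cosine_real.
have FF : eigenproj *m eigenproj = (\sum_(j < D.+1) k j * cosine j ^+ 2) *: eigenproj.
  rewrite {1}eigenprojE mulmx_suml scaler_suml; apply: eq_bigr => j _.
  rewrite -scalemxAl dist_mx_eigen; [|exact: dist_eigenproj | exact: ltnSE].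
  by rewrite scalerA mulrCA -expr2.
by rewrite -inner_mull // mulmxA FF -scalemxAl innerZl Fvv mulr0.
Qed.

End CosineSequence.

(** * Seeds of endpoint 0, 1 and 2 *)

Section Seeds.
Variables (K : numClosedFieldType) (X : finType) (e : rel X) (x : X).
Hypothesis Gamma_dr : distance_regular e.
Hypothesis bip : bipartite e.

Local Notation V := 'cV[K]_#|X|.
Local Notation d := (gdist e).
Local Notation D := (diameter e).
Local Notation A := (dist_mx K e).
Local Notation Es := (Estar K e x).
Local Notation b i := (b_num e i)%:R.
Local Notation c i := (c_num e i)%:R.

Let conn : simple_connected_graph e. Proof. by case: Gamma_dr. Qed.

Lemma sum_three (M : nmodType) (F : nat -> M) n a :
  (forall j, j != a -> j != a.+2 -> j != a.+4 -> F j = 0) ->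
  (forall j, (n < j)%N -> F j = 0) ->
  \sum_(j < n.+1) F j = F a + F a.+2 + F a.+4.
Proof.
move=> F0 Fn; transitivity (\sum_(0 <= j < n.+1 + a.+4.+1) F j).
  rewrite -(big_mkord xpredT F) [RHS](big_cat_nat (n := n.+1)) ?leq_addr //=.
  rewrite [X in _ = _ + X]big_nat_cond [X in _ = _ + X]big1 ?addr0 // => j.
  by rewrite andbT => /andP[/Fn].
rewrite big_mkord; have lt j : (j <= a.+4)%N -> (j < n.+1 + a.+4.+1)%N by lia.
have la : (a <= a.+4)%N by lia.
have la2 : (a.+2 <= a.+4)%N by lia.
rewrite (bigD1 (Ordinal (lt _ la))) // (bigD1 (Ordinal (lt _ la2))) /=; last first.
  by rewrite -val_eqE /=; lia.
rewrite (bigD1 (Ordinal (lt _ (leqnn _)))) /=; last by rewrite -!val_eqE /=; lia.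
rewrite big1 ?addr0 ?addrA // => j; rewrite -!val_eqE /= => /andP[/andP[? ?] ?].
exact: F0.
Qed.

(** Of the distance matrices, only those at the distances [s], [s.+2] and [s.+4]
    lead from the sphere of radius [r] to the one of radius [r + s]. *)
Lemma Estar_sum_three r s (v : V) (f : nat -> K) : (r <= 2)%N -> Es r *m v = v ->
  Es (r + s) *m ((\sum_(j < D.+1) f j *: A j) *m v) =
    f s *: (Es (r + s) *m (A s *m v)) +
    f s.+2 *: (Es (r + s) *m (A s.+2 *m v)) +
    f s.+4 *: (Es (r + s) *m (A s.+4 *m v)).
Proof.
move=> r2 rv; rewrite mulmx_suml mulmx_sumr.
rewrite -(@sum_three _ (fun j => f j *: (Es (r + s) *m (A j *m v))) D s).
- by apply: eq_bigr => j _; rewrite -scalemxAl -scalemxAr.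
- move=> j j0 j2 j4; rewrite -rv Estar_dist_Estar ?scaler0 //.
  apply/negP; lia.
- by move=> j Dj; rewrite dist_mx_far // mul0mx mulmx0 scaler0.
Qed.

(** The sum is [Es (r + s)] applied to the product of the all-one matrix with [v],
    and the last hypothesis says that the entries of [v] sum to zero. *)
Lemma Estar_sum_dist_eq0 r s (v : V) : (r <= 2)%N -> Es r *m v = v ->
  Es 0 *m (A r *m v) = 0 ->
  Es (r + s) *m (A s *m v) + Es (r + s) *m (A s.+2 *m v) +
    Es (r + s) *m (A s.+4 *m v) = 0.
Proof.
move=> r2 rv v_sum; have := Estar_sum_three s (fun _ => 1) r2 rv.
rewrite !scale1r => <-.
suff -> : (\sum_(j < D.+1) 1 *: A j) *m v = 0 by rewrite mulmx0.
have -> : \sum_(j < D.+1) 1 *: A j = const_mx 1.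
  by rewrite -(sum_dist_mx K e); apply: eq_bigr => j _; rewrite scale1r.
have Jv : Es 0 *m ((const_mx 1 : 'M_#|X|) *m v) = 0.
  rewrite -(sum_dist_mx K e) mulmx_suml mulmx_sumr big1 // => j _.
  have [->//|jr] := eqVneq (j : nat) r.
  by rewrite -rv Estar_dist_Estar //; apply/negP; lia.
apply/colP=> i; move/colP/(_ (enum_rank x)): Jv.
rewrite EstarE enum_rankK gdistxx // mul1r !mxE => Jv.
by rewrite -[RHS]Jv; apply: eq_bigr => s' _; rewrite !mxE.
Qed.

Lemma seed0 v : Es 0 *m v = v -> seed e x 0 (fun _ => 0) v.
Proof.
move=> v0; split=> // s; rewrite scale0r -v0 Estar_dist_Estar //.
by apply/negP; lia.
Qed.

Lemma seed1 v : Es 1 *m v = v -> Es 0 *m (A 1 *m v) = 0 ->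
  seed e x 1 (fun _ => -1) v.
Proof.
move=> v1 v_sum; split=> // [[|i]//|s].
have := Estar_sum_dist_eq0 s (isT : (1 <= 2)%N) v1 v_sum.
rewrite -[in A s.+4 *m _]v1 Estar_dist_Estar // ?addr0; last by apply/negP; lia.
by move/eqP; rewrite addrC addr_eq0 scaleN1r => /eqP.
Qed.

Hypothesis D_ge4 : (4 <= D)%N.

Let D_gt0 : (0 < D)%N. Proof. exact: leq_trans D_ge4. Qed.

Section LocalEigenvector.
Variables (t eta : K) (v : V).
Let u := cosine e t.

Hypothesis t_eig : eigenvalue (A 1) t.
Hypothesis t_re : t \is Num.real.
Hypothesis u_neq : forall m, (0 < m < D)%N -> u m.-1 != u m.+1.
Hypothesis eta_def : eta = - 1 - (b 2 * b 3) / (t ^+ 2 - b 2).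
Hypothesis v2 : Es 2 *m v = v.
Hypothesis v_low : Es 1 *m (A 1 *m v) = 0.
Hypothesis v_eta : local_op K e x *m v = eta *: v.

Lemma Estar0_dist2 : Es 0 *m (A 2 *m v) = 0.
Proof.
have := Estar_nbr x Gamma_dr bip 0 (A 1 *m v).
rewrite v_low !mulmx0 add0r Estar_dist_Estar // [A 1 *m (A 1 *m v)]mulmxA.
rewrite dist_mx_mulS // dist_mx0 // mulmxDl mulmxDr -!scalemxAl mul1mx -!scalemxAr.
rewrite -{2}v2 Estar_orth // scaler0 addr0 => /eqP.
by rewrite scaler_eq0 (negPf (c_neq0 K x Gamma_dr _)) ?(leq_trans _ D_ge4) // => /eqP.
Qed.

(** Eliminate [u 1] and [u 3] from the first four equations of the recurrence. *)
Lemma cosine_quotient : b 2 * b 3 * (u 2 - u 4) = (1 - u 2) * (t ^+ 2 - b 2).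
Proof.
have tu := cosine_eigenseq x Gamma_dr bip D_gt0 t_eig.
have u0 : u 0 = 1 by [].
have E0 := tu 0%N isT; have E1 := tu 1%N D_gt0.
have E2 := tu 2%N (leq_trans (isT : 2 <= 4)%N D_ge4).
have E3 := tu 3%N (leq_trans (isT : 3 <= 4)%N D_ge4).
move: E0 E1 E2 E3; rewrite -/u /= u0 (c_num0 Gamma_dr x) (c_num1 Gamma_dr x) //.
have bc i : (i <= 4)%N -> b i = (valency e)%:R - c i :> K.
  move=> i4; rewrite -(bc_valency Gamma_dr x bip (leq_trans i4 D_ge4)).
  by rewrite natrD addrK.
rewrite (bc 0%N) // (bc 1%N) // (bc 2%N) // (bc 3%N) // (c_num0 Gamma_dr x) (c_num1 Gamma_dr x) //.
move: (c 2) (c 3) (valency e)%:R => c2 c3 k E0 E1 E2 E3.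
have E3' : (k - c3) * u 4 = t * u 3 - c3 * u 2 by rewrite -E3 [RHS]addrC addKr.
have E2' : (k - c2) * u 3 = t * u 2 - c2 * u 1 by rewrite -E2 [RHS]addrC addKr.
have E1' : t * u 1 = 1 + (k - 1) * u 2 by rewrite -E1 mul1r.
have tt : t ^+ 2 = k * (1 + (k - 1) * u 2).
  by rewrite -E1' expr2 -{2}[t]mulr1 -E0; ring.
transitivity ((k - c2) * (k - c3) * u 2 - (k - c2) * ((k - c3) * u 4)); first by ring.
rewrite E3'; transitivity ((k - c2) * k * u 2 - t * ((k - c2) * u 3)); first by ring.
rewrite E2'; transitivity ((k - c2) * k * u 2 - t ^+ 2 * u 2 + c2 * (t * u 1)); first by ring.
by rewrite E1' tt; ring.
Qed.

Let u_neq24 : u 2 != u 4.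
Proof. by apply: (u_neq (m := 3)); rewrite D_ge4. Qed.

(** Otherwise [cosine_quotient] would give [u 2 = u 4]. *)
Lemma eigenvalue_sqr_neq : t ^+ 2 - b 2 != 0.
Proof.
apply/eqP=> t2; have /eqP := cosine_quotient; rewrite t2 mulr0 !mulf_eq0 subr_eq0.
by rewrite (negPf u_neq24) !(negPf (b_neq0 K x Gamma_dr _)) ?(leq_trans _ D_ge4).
Qed.

Lemma eta_cosine : 1 + eta * u 2 - (1 + eta) * u 4 = 0.
Proof.
apply: (mulIf eigenvalue_sqr_neq); rewrite mul0r.
have eta1 : (1 + eta) * (t ^+ 2 - b 2) = - (b 2 * b 3).
  rewrite eta_def addrA subrr add0r mulNr divfK //; exact: eigenvalue_sqr_neq.
transitivity ((1 + eta) * (t ^+ 2 - b 2) * (u 2 - u 4) + (1 - u 2) * (t ^+ 2 - b 2)).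
  by ring.
by rewrite eta1 -cosine_quotient; ring.
Qed.

Let v_sum s : Es (2 + s) *m (A s *m v) + Es (2 + s) *m (A s.+2 *m v) +
    Es (2 + s) *m (A s.+4 *m v) = 0.
Proof. exact: Estar_sum_dist_eq0 v2 Estar0_dist2. Qed.

(** The squared norm of the projection of [v] onto the eigenspace of [t] is a
    multiple of [1 + eta * u 2 - (1 + eta) * u 4]. *)
Lemma local_eigenvector_orth : eigenproj e t *m v = 0.
Proof.
apply: (eigenproj_kernel x) => //.
rewrite -[X in inner _ X]v2 -inner_Estar eigenprojE //.
have A2v : Es 2 *m (A 2 *m v) = eta *: v.
  by rewrite -v_eta /local_op -!mulmxA v2.
have A4v : Es 2 *m (A 4 *m v) = - ((1 + eta) *: v).
  have := v_sum 0; rewrite addn0 A2v dist_mx0 // mul1mx v2 => /eqP.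
  by rewrite addrC addr_eq0 scalerDl scale1r => /eqP.
have := Estar_sum_three 0 u (isT : (2 <= 2)%N) v2.
rewrite addn0 A2v A4v dist_mx0 // mul1mx v2 -scaleNr !scalerA -!scalerDl => ->.
rewrite innerZl (_ : _ + _ = 0) ?mul0r // -[RHS]eta_cosine.
by rewrite [u 0](_ : _ = 1) //; ring.
Qed.

(** Beyond [D] the third of the vectors in [Estar_sum_three] is zero, and the
    first two are opposite. *)
Definition gamma s : K :=
  if (s.+4 <= D)%N then - (u s - u s.+4) / (u s.+2 - u s.+4) else -1.

Lemma seed2 : seed e x 2 gamma v.
Proof.
split=> // [[|[|//]] _|s]; first by rewrite -v2 Estar_dist_Estar.
  exact: v_low.
rewrite /gamma; have := v_sum s; case: ifPn => sD; last first.
  rewrite [A s.+4]dist_mx_far 1?ltnNge // mul0mx mulmx0 addr0 scaleN1r => /eqP.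
  by rewrite addrC addr_eq0 => /eqP.
have := Estar_sum_three s u (isT : (2 <= 2)%N) v2.
rewrite -(eigenprojE e) local_eigenvector_orth mulmx0.
have un : u s.+2 - u s.+4 != 0 by rewrite subr_eq0 (u_neq (m := s.+3)).
move: (Es _ *m (A s *m v)) (Es _ *m (A s.+2 *m v)) (Es _ *m (A s.+4 *m v)).
move=> q w p Ef /eqP; rewrite addrC addr_eq0 => /eqP pE.
apply: (scalerI un); rewrite scalerA mulrCA divff // mulr1.
apply/eqP; rewrite -subr_eq0 scaleNr opprK; apply/eqP; rewrite {}Ef {}pE.
by apply/colP=> i; rewrite !mxE; ring.
Qed.

End LocalEigenvector.

End Seeds.

(** * Subspaces that split along a direct sum *)

Section SplittingSubspaces.
Variables (F : fieldType) (vT : vectType F) (n : nat) (S : 'I_n -> {vspace vT}).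
Hypothesis S_dx : directv (\sum_i S i).

(** For subspaces of the sum of the [S i], this says that [L] is the sum of its
    intersections with the summands. *)
Definition splits (L : {vspace vT}) : Prop :=
  forall vs : 'I_n -> vT, (forall i, vs i \in S i) ->
    \sum_i vs i \in L -> forall i, vs i \in L.

Lemma splits_cap L L' : splits L -> splits L' -> splits (L :&: L')%VS.
Proof.
move=> sL sL' vs Svs; rewrite memv_cap => /andP[Lvs L'vs] i.
by rewrite memv_cap sL ?sL'.
Qed.

Lemma splits_lker (f : 'End(vT)) :
  (forall i v, v \in S i -> f v \in S i) -> splits (lker f).
Proof.
move=> fS vs Svs; rewrite memv_ker linear_sum => /eqP fvs0 i; rewrite memv_ker.
have /(_ (fun i => f (vs i))) := directv_sum_independent S_dx.
by move=> -> // j _; apply/fS/Svs.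
Qed.

Lemma dim_splits L : splits L -> (L <= \sum_i S i)%VS ->
  \dim L = (\sum_i \dim (L :&: S i))%N.
Proof.
move=> sL L_sub; have LE : L = (\sum_i (L :&: S i))%VS.
  apply/eqP; rewrite eqEsubv; apply/andP; split; last first.
    by apply/subv_sumP=> i _; apply: capvSl.
  apply/subvP=> v Lv; have /memv_sumP[vs Svs vE] := subvP L_sub _ Lv.
  rewrite vE memv_suml // => i _; apply: (subvP (sumv_sup i _ (subvv _))) => //.
  by rewrite memv_cap Svs // sL -?vE // => j; apply: Svs.
rewrite [in LHS]LE; apply/directvP/directv_sum_independent=> us Uus us0 i Pi.
have /directv_sum_independent/(_ us) := S_dx; apply=> // j Pj.
by have := Uus j Pj; rewrite memv_cap => /andP[].
Qed.

End SplittingSubspaces.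

(** * Orthogonal decompositions into irreducible modules *)

Section OrthogonalDecomposition.
Variables (K : numClosedFieldType) (X : finType) (e : rel X) (x : X).
Hypothesis Gamma_dr : distance_regular e.

Local Notation V := 'cV[K]_#|X|.
Local Notation D := (diameter e).
Local Notation A := (dist_mx K e).
Local Notation Es := (Estar K e x).
Local Notation T_module := (@T_module K X e x).
Local Notation T_irreducible := (@T_irreducible K X e x).

(** The orthogonal complement, as the kernel of the inner products with a
    basis. *)
Definition orthv (W : {vspace V}) : {vspace V} :=
  lker (linfun (mulmx (\matrix_(i < \dim W, r < #|X|) Num.conj ((vbasis W)`_i r 0)))).

Lemma orthvP (W : {vspace V}) v :
  reflect (forall w, w \in W -> inner v w = 0) (v \in orthv W).
Proof.
rewrite memv_ker lfunE /=; apply: (iffP eqP) => [v0 w Ww|v0].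
  rewrite (coord_vbasis Ww) inner_sumr big1 // => i _; rewrite innerZr.
  suff -> : inner v (vbasis W)`_i = 0 by rewrite mulr0.
  move/colP/(_ i): v0; rewrite !mxE innerE => v0; rewrite -[RHS]v0.
  by apply: eq_bigr => r _; rewrite !mxE mulrC.
apply/colP=> i; rewrite !mxE; have bW : (vbasis W)`_i \in W.
  by rewrite vbasis_mem ?mem_nth ?size_tuple.
by apply: etrans (v0 _ bW); rewrite innerE; apply: eq_bigr => r _; rewrite !mxE mulrC.
Qed.

(** The form is definite, so the intersection is zero, and the complement is
    defined by [\dim W] equations. *)
Lemma orthv_add (W : {vspace V}) : (W + orthv W)%VS = fullv.
Proof.
have cap0 : (W :&: orthv W)%VS = 0%VS.
  apply/eqP; rewrite -subv0; apply/subvP=> v; rewrite memv_cap => /andP[Wv /orthvP/(_ v Wv)].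
  by move/eqP; rewrite inner_eq0 memv0.
apply/eqP; rewrite eqEdim subvf dimv_disjoint_sum //= /orthv.
set f := linfun _; rewrite -(limg_ker_dim f fullv) capfv addnC leq_add2r.
apply: leq_trans (dimvS (subvf _)) _.
by rewrite dimvf /dim /= muln1.
Qed.

(** The generators of [T] are self-adjoint. *)
Lemma T_module_orthv W : T_module W -> T_module (orthv W).
Proof.
move=> /T_moduleP[WA WE]; apply/T_moduleP; split=> [v|i v] /orthvP vW; apply/orthvP=> w Ww.
  by rewrite inner_dist ?vW ?WA.
by rewrite inner_Estar vW ?WE.
Qed.

Lemma T_module_cap W W' : T_module W -> T_module W' -> T_module (W :&: W')%VS.
Proof.
move=> Wmod Wmod' B TB; apply/subvP=> _ /memv_imgP[w /memv_capP[Ww Ww'] ->].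
by rewrite memv_cap !(subvP (Wmod B TB), subvP (Wmod' B TB)) ?memv_img.
Qed.

Lemma T_module_full : T_module fullv.
Proof. by move=> B _; apply: subvf. Qed.

Lemma exists_irreducible (M : {vspace V}) : T_module M -> M != 0%VS ->
  exists2 W, T_irreducible W & (W <= M)%VS.
Proof.
have [m] := ubnP (\dim M); elim: m M => // m IHm M dM Mmod M0.
have [[W [Wmod W0 sWM WM]]|noW] := pselect
    (exists W, [/\ T_module W, W != 0%VS, (W <= M)%VS & W != M]).
  have dW : (\dim W < m)%N.
    apply: leq_trans (dM : (\dim M <= m)%N).
    by rewrite ltn_neqAle dimvS // andbT (dimv_leqif_eq sWM).
  have [W' W'irr sW'W] := IHm W dW Wmod W0.
  by exists W' => //; apply: subv_trans sWM.
exists M => //; split=> // W' W'mod sW'.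
have [->|W'0] := eqVneq W' 0%VS; [by left | right].
by apply/eqP/negPn/negP=> W'M; apply: noW; exists W'.
Qed.

Lemma nth_sub_sum (Ws : seq {vspace V}) i : (i < size Ws)%N ->
  (nth 0%VS Ws i <= \sum_(W <- Ws) W)%VS.
Proof.
by move=> lt_i; rewrite (big_nth 0%VS) big_mkord (sumv_sup (Ordinal lt_i)).
Qed.

Lemma exists_orth_decomposition : exists Ws, @orth_decomposition K X e x Ws.
Proof.
suff dec (M : {vspace V}) : T_module M -> exists Ws,
    [/\ forall W, W \in Ws -> T_irreducible W,
      forall i j : nat, (i < size Ws)%N -> (j < size Ws)%N -> i != j ->
        forall u v, u \in nth 0%VS Ws i -> v \in nth 0%VS Ws j -> inner u v = 0
    & (\sum_(W <- Ws) W)%VS = M].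
  by have [Ws] := dec _ T_module_full; exists Ws.
have [m] := ubnP (\dim M); elim: m M => // m IHm M dM Mmod.
have [->|M0] := eqVneq M 0%VS; first by exists [::]; split=> //; rewrite big_nil.
have [W Wirr sWM] := exists_irreducible Mmod M0.
have [Wmod W0 _] := Wirr.
have Nmod := T_module_cap (T_module_orthv Wmod) Mmod.
have WN : (W + (orthv W :&: M))%VS = M by rewrite vspace_modl // orthv_add capfv.
have dN : (\dim (orthv W :&: M) < m)%N.
  have sNM : (orthv W :&: M <= M)%VS by apply: capvSr.
  apply: leq_trans (dM : (\dim M <= m)%N).
  rewrite ltn_neqAle dimvS // andbT (dimv_leqif_eq sNM).
  apply: contra W0 => /eqP NM; rewrite -subv0; apply/subvP=> w Ww.
  have := subvP sWM w Ww; rewrite -NM memv_cap => /andP[/orthvP/(_ w Ww)/eqP].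
  by rewrite inner_eq0 memv0.
have [Ws [Wsirr Wsorth Wssum]] := IHm _ dN Nmod.
have Ws_orth i u v : (i < size Ws)%N -> u \in W -> v \in nth 0%VS Ws i -> inner v u = 0.
  move=> lt_i Wu iv; have := subvP (nth_sub_sum lt_i) _ iv.
  by rewrite Wssum memv_cap => /andP[/orthvP/(_ u Wu)].
exists (W :: Ws); split=> [W'|[|i] [|j]|]; last by rewrite big_cons Wssum.
- by rewrite in_cons => /predU1P[->|/Wsirr].
- by [].
- by move=> _ lt_j _ u v /= Wu jv; rewrite innerC (Ws_orth j u v) ?rmorph0.
- by move=> lt_i _ _ u v /= iu Wv; apply: (Ws_orth i).
- by move=> lt_i lt_j ij; apply: Wsorth.
Qed.

Lemma orth_directv n (S : 'I_n -> {vspace V}) :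
  (forall i j, i != j -> forall u v, u \in S i -> v \in S j -> inner u v = 0) ->
  directv (\sum_i S i).
Proof.
move=> orth; apply/directv_sum_independent=> us Sus us0 i _.
apply/eqP; rewrite -inner_eq0; have := inner0l (us i); rewrite -us0 inner_suml.
rewrite (bigD1 i) //= big1 ?addr0 => [->//|j ji].
by apply: orth ji _ _ _ _; apply: Sus.
Qed.

End OrthogonalDecomposition.

(** * The space U and the multiplicity *)

Section LocalSpace.
Variables (K : numClosedFieldType) (X : finType) (e : rel X) (x : X).
Hypothesis Gamma_dr : distance_regular e.
Hypothesis bip : bipartite e.
Hypothesis D_gt1 : (1 < diameter e)%N.

Local Notation V := 'cV[K]_#|X|.
Local Notation d := (gdist e).
Local Notation D := (diameter e).
Local Notation A := (dist_mx K e).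
Local Notation Es := (Estar K e x).
Local Notation T_module := (@T_module K X e x).
Local Notation T_irreducible := (@T_irreducible K X e x).
Local Notation Estar_im := (@Estar_im K X e x).
Local Notation endpoint := (@endpoint K X e x).

Let conn : simple_connected_graph e. Proof. by case: Gamma_dr. Qed.
Let D_gt0 : (0 < D)%N. Proof. exact: ltnW. Qed.

Lemma mem_leigenspace (B : 'M[K]_#|X|) a v :
  (v \in passmx.leigenspace (mxact B) a) = (B *m v == a *: v).
Proof. by rewrite memv_ker add_lfunE opp_lfunE scale_lfunE id_lfunE mxactE subr_eq0. Qed.

Lemma endpoint_vector (W : {vspace V}) r : T_irreducible W -> endpoint W = r ->
  exists v, [/\ v \in W, v != 0, Es r *m v = v &
                forall i, (i < r)%N -> Es i *m (A 1 *m v) = 0].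
Proof.
move=> [/T_moduleP[WA WE] W0 _] Wr.
have [_ Er low] := endpointP e x W0; rewrite Wr in Er low.
have /Estar_imP[w Ww vE] : vpick (Estar_im r W) \in Estar_im r W by apply: memv_pick.
exists (vpick (Estar_im r W)); split.
- by rewrite vE WE.
- by rewrite vpick0.
- by rewrite vE EstarK.
- by move=> i ir; rewrite low // WA // vE WE.
Qed.

Definition xhat : V := \col_r (r == enum_rank x)%:R.

Lemma Estar0E v : Es 0 *m v = v (enum_rank x) 0 *: xhat.
Proof.
apply/colP=> r; rewrite EstarE !mxE (gdist_eq0 conn) mulrC.
case: (x =P enum_val r) => [->|xr]; first by rewrite enum_valK eqxx.
have /negPf-> : r != enum_rank x by apply/eqP=> rx; apply: xr; rewrite rx enum_rankK.
by rewrite !mulr0.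
Qed.

Lemma Estar_xhat : Es 0 *m xhat = xhat.
Proof. by rewrite Estar0E mxE eqxx scale1r. Qed.

Lemma xhat_neq0 : xhat != 0.
Proof.
by apply/eqP=> /colP/(_ (enum_rank x))/eqP; rewrite !mxE eqxx oner_eq0.
Qed.

(** There is only one line on the sphere of radius 0, so the module contains
    [xhat]. *)
Lemma endpoint0_chain (W : {vspace V}) : T_irreducible W -> endpoint W = 0%N ->
  W = chain_mod e x 0 xhat.
Proof.
move=> Wirr /(endpoint_vector Wirr)[v [Wv v0 Ev _]].
apply: (chain_mod_unique Gamma_dr bip D_gt0 (seed0 Gamma_dr bip Estar_xhat) xhat_neq0 Wirr).
move: Ev Wv; rewrite Estar0E => Ev; rewrite -Ev memv_scale //.
by apply: contraNneq v0 => vx; rewrite -Ev vx scale0r.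
Qed.

Lemma endpoint1_chain (W : {vspace V}) : T_irreducible W -> endpoint W = 1%N ->
  exists v, [/\ seed e x 1 (fun _ => -1) v, v != 0 & W = chain_mod e x 1 v].
Proof.
move=> Wirr /(endpoint_vector Wirr)[v [Wv v0 Ev low]].
have vs := seed1 Gamma_dr bip Ev (low 0%N isT).
by exists v; split=> //; apply: (chain_mod_unique Gamma_dr bip D_gt0 vs v0 Wirr).
Qed.

Lemma V0E : V0 K e x = chain_mod e x 0 xhat.
Proof.
have s0 := seed0 Gamma_dr bip Estar_xhat.
apply: xget_unique => [|W [Wirr W0]]; last exact: endpoint0_chain.
split; first exact: (chain_mod_irr Gamma_dr bip D_gt0 s0 xhat_neq0).
exact: (chain_mod_endpoint Gamma_dr D_gt0 s0 xhat_neq0).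
Qed.

(** The intersection of all subspaces with a property closed under
    intersection is the one of smallest dimension. *)
Lemma vspace_of_bigcap (P : {vspace V} -> Prop) :
  P fullv -> (forall S S', P S -> P S' -> P (S :&: S')%VS) ->
  forall v, v \in vspace_of (fun v => forall S, P S -> v \in S) <->
            forall S, P S -> v \in S.
Proof.
move=> Pfull Pcap.
apply: (@xgetPex _ 0%VS (fun W : {vspace V} =>
          forall v, v \in W <-> forall S, P S -> v \in S)).
pose Q n := `[< exists2 S, P S & \dim S = n >].
have exQ : exists n, Q n by exists (\dim {:V}); apply/asboolP; exists fullv.
case: (ex_minnP exQ) => n /asboolP[S' PS' dS'] min.
exists S' => v; split=> [S'v S2 PS2|]; last exact.
have sub : (S' :&: S2 <= S')%VS by apply: capvSl.
suff : (S' :&: S2)%VS = S' by move=> E; move: S'v; rewrite -E memv_cap => /andP[].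
apply/eqP; rewrite eqEdim sub dS'; apply: min; apply/asboolP.
by exists (S' :&: S2)%VS => //; apply: Pcap.
Qed.

Lemma YspanP v : v \in Yspan K e x <-> forall S : {vspace V},
  (forall W, T_irreducible W -> endpoint W = 1%N -> (W <= S)%VS) -> v \in S.
Proof.
apply: (@vspace_of_bigcap (fun S : {vspace V} =>
  forall W, T_irreducible W -> endpoint W = 1%N -> (W <= S)%VS)).
  by move=> W _ _; apply: subvf.
by move=> S S' SP S'P W Wi W1; rewrite subv_cap SP ?S'P.
Qed.

Lemma sub_Yspan (W : {vspace V}) : T_irreducible W -> endpoint W = 1%N -> (W <= Yspan K e x)%VS.
Proof.
move=> Wi W1; apply/subvP=> w Ww; apply/YspanP=> S SP.
exact: (subvP (SP W Wi W1)).
Qed.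

Lemma dist_Yspan y : y \in Yspan K e x -> A 1 *m y \in Yspan K e x.
Proof.
move=> /YspanP Yy; apply/YspanP=> S SP; rewrite -mxactE memv_preim.
apply: Yy => W Wi W1; apply/subvP=> w Ww; rewrite -memv_preim mxactE.
by have [/T_moduleP[WA _] _ _] := Wi; rewrite (subvP (SP W Wi W1)) ?WA.
Qed.

Definition lowest (v : V) : Prop := Es 2 *m v = v /\ Es 1 *m (A 1 *m v) = 0.

(** A chain that starts below the second sphere reaches it by raising, and
    raising is adjoint to lowering. *)
Lemma lowest_chain r g w s v : seed e x r g w -> (r + s.+1 = 2)%N -> lowest v ->
  inner v (chain e x r w s.+1) = 0.
Proof.
move=> ws rs [v2 v1]; have rs1 : (r + s = 1)%N by lia.
have sD : (s < D)%N by lia.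
have cs : Num.conj ((c_num e s.+1)%:R : K) != 0 by rewrite rmorph_nat c_neq0.
apply: (mulfI cs); rewrite mulr0 -innerZr -(chain_raise Gamma_dr bip D_gt0 ws).
rewrite -inner_Estar rs1 v2 -inner_dist // -(Estar_chain e x r w s) rs1.
by rewrite -inner_Estar v1 inner0l.
Qed.

(** Decompose into irreducible modules: only those of endpoint 0 or 1 have a
    component on the first sphere. *)
Lemma V0_Yspan_Estar1 (w : V) : Es 1 *m w = w -> w \in (V0 K e x + Yspan K e x)%VS.
Proof.
move=> Ew; have [Ws [Wsirr _ Wsum]] := exists_orth_decomposition K x Gamma_dr.
have : w \in fullv by apply: memvf.
rewrite -Wsum (big_nth 0%VS) big_mkord => /memv_sumP[ws Wws wE].
rewrite -Ew wE mulmx_sumr memv_suml // => i _.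
have Wi : T_irreducible (nth 0%VS Ws i) by apply/Wsirr/mem_nth.
have [/T_moduleP[WA WE] Wi0 _] := Wi.
have [_ _ low] := endpointP e x Wi0.
case: (ltngtP (endpoint (nth 0%VS Ws i)) 1) => [lt1|gt1|e1].
- apply: (subvP (addvSl _ _)); rewrite V0E -(endpoint0_chain Wi) ?WE ?Wws //.
  by move: lt1; case: endpoint.
- by rewrite low ?mem0v ?Wws.
- by apply: (subvP (addvSr _ _)); apply: (subvP (sub_Yspan Wi e1)); rewrite WE ?Wws.
Qed.

(** The modules of endpoint 0 and 1 contain the first sphere, so orthogonality to
    them kills [Es 1 *m (A 1 *m v)]; conversely these modules are chains, and
    reach the second sphere by raising. *)
Lemma lowestP v : lowest v <->
  v \in Estar_im 2 fullv /\
  forall w, w \in (Estar_im 2 (V0 K e x) + Estar_im 2 (Yspan K e x))%VS -> inner v w = 0.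
Proof.
split=> [vlow|[v2 vorth]]; last first.
  have Ev : Es 2 *m v = v by case/Estar_imP: v2 => w _ ->; rewrite EstarK.
  split=> //; apply/eqP; rewrite -inner_eq0.
  set w := Es 1 *m _; have Ew : Es 1 *m w = w by apply: EstarK.
  rewrite {1}/w inner_Estar Ew inner_dist // -[X in inner X _]Ev inner_Estar; apply/eqP.
  have /memv_addP[w0 V0w [w1 Yw wE]] := V0_Yspan_Estar1 Ew.
  apply: vorth; rewrite wE !mulmxDr memv_add //; apply/Estar_imP.
    exists (A 1 *m w0) => //; move: V0w; rewrite V0E.
    by case/T_moduleP: (chain_mod_T Gamma_dr bip D_gt0 (seed0 Gamma_dr bip Estar_xhat)) => CA _ /CA.
  by exists (A 1 *m w1); rewrite ?dist_Yspan.
have [v2 v1] := vlow; split; first by apply/Estar_imP; exists v; rewrite ?memvf.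
move=> w /memv_addP[_ /Estar_imP[w0 V0w ->] [_ /Estar_imP[w1 Yw ->] ->]].
rewrite innerDr -!inner_Estar v2.
have -> : inner v w0 = 0.
  rewrite -v2 inner_Estar; have : Es 2 *m w0 \in Estar_im (0 + 2) (chain_mod e x 0 xhat).
    by apply/Estar_imP; exists w0; rewrite -?V0E.
  move/(subvP (Estar_chain_mod_sub _ _ _ _ _))/vlineP => [a ->].
  by rewrite innerZr (lowest_chain (seed0 Gamma_dr bip Estar_xhat)) // mulr0.
suff : w1 \in orthv <[v]>%VS.
  by move/orthvP/(_ v (memv_line v)) => E; rewrite add0r innerC E rmorph0.
move/YspanP: Yw; apply=> W Wi /(endpoint1_chain Wi)[u [us u0 ->]].
apply/subvP=> y Wy; apply/orthvP=> _ /vlineP[a ->].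
rewrite innerZr -v2 -inner_Estar innerC.
have : Es 2 *m y \in Estar_im (1 + 1) (chain_mod e x 1 u) by apply/Estar_imP; exists y.
move/(subvP (Estar_chain_mod_sub _ _ _ _ _))/vlineP => [a' ->].
by rewrite innerZr (lowest_chain us) // mulr0 rmorph0 mulr0.
Qed.

Definition lowest_space : {vspace V} :=
  (lker (mxact (1%:M - Es 2)) :&: lker (mxact (Es 1 *m A 1)))%VS.

Lemma mem_lowest_space v : v \in lowest_space <-> lowest v.
Proof.
rewrite memv_cap !memv_ker !mxactE mulmxBl mul1mx subr_eq0 -mulmxA /lowest.
split=> [/andP[/eqP <- /eqP ->]|[-> ->]]; rewrite ?EstarK ?eqxx //.
Qed.

Lemma UspaceE : Uspace K e x = lowest_space.
Proof.
have UP : exists W : {vspace V}, forall v, v \in W <-> (v \in Estar_im 2 fullv /\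
    forall w, w \in (Estar_im 2 (V0 K e x) + Estar_im 2 (Yspan K e x))%VS -> inner v w = 0).
  by exists lowest_space => v; rewrite mem_lowest_space lowestP.
have UP' := xgetPex 0%VS UP.
apply/vspaceP=> v; apply/idP/idP.
  by move/(iffLR (UP' v))/(iffRL (lowestP v))/(iffRL (mem_lowest_space v)).
by move=> /(iffLR (mem_lowest_space v))/(iffLR (lowestP v))/(iffRL (UP' v)).
Qed.

Lemma UetaP eta v : v \in Ueta e x eta <-> lowest v /\ local_op K e x *m v = eta *: v.
Proof.
rewrite /Ueta UspaceE memv_cap mem_leigenspace; split.
  by case/andP=> /(iffLR (mem_lowest_space v)) vlow /eqP.
by case=> /(iffRL (mem_lowest_space v)) -> ->; rewrite eqxx.
Qed.

Section Multiplicity.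
Variables (eta : K) (g : nat -> K).
Hypothesis eta_seed : forall v, v \in Ueta e x eta -> seed e x 2 g v.

Lemma thin_endpoint2_chain (W : {vspace V}) : thin_endpoint2 e x eta W ->
  exists v, [/\ v \in Ueta e x eta, v != 0 & W = chain_mod e x 2 v].
Proof.
move=> [Wirr W2 _ /subvP Weta].
have [v [Wv v0 Ev low]] := endpoint_vector Wirr W2.
have Uv : v \in Ueta e x eta.
  apply/UetaP; split; first by split=> //; apply: low.
  have : v \in Estar_im 2 W by apply/Estar_imP; exists v.
  by move/Weta; rewrite mem_leigenspace => /eqP.
exists v; split=> //.
exact: (chain_mod_unique Gamma_dr bip D_gt0 (eta_seed Uv) v0 Wirr).
Qed.

Lemma chain_thin_endpoint2 v : v \in Ueta e x eta -> v != 0 ->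
  thin_endpoint2 e x eta (chain_mod e x 2 v).
Proof.
move=> Uv v0; have vs := eta_seed Uv; have [_ v_eta] := iffLR (UetaP _ _) Uv.
split.
- exact: chain_mod_irr vs v0.
- exact: chain_mod_endpoint vs v0.
- exact: chain_mod_thin.
rewrite /has_local_eigenvalue (Estar_chain_mod Gamma_dr D_gt0 vs) -memvE.
by rewrite mem_leigenspace v_eta.
Qed.

(** The recurrence expresses [A 2] by [A 1 *m A 1] and the identity, and the
    latter is [Es 2] between two factors [Es 2]. *)
Lemma in_T_local_op : in_T e x (local_op K e x).
Proof.
have TE : in_T e x (Es 2) by constructor.
have c2 := c_neq0 K x Gamma_dr D_gt1.
have -> : local_op K e x = (c_num e 2)%:R^-1 *:
    (Es 2 *m (A 1 *m A 1) *m Es 2 + (- (b_num e 0)%:R) *: Es 2).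
  apply: (scalerI c2); rewrite scalerA divff // scale1r dist_mx_mulS // dist_mx0 //.
  rewrite mulmxDr mulmxDl -!scalemxAr -!scalemxAl mulmx1 -[Es 2 *m Es 2]mulmx1 -mulmxA.
  by rewrite EstarK mulmx1 scaleNr addrK.
by do !constructor.
Qed.

(** The equations that define [Ueta] involve only elements of [T]. *)
Lemma Ueta_splits n (S : 'I_n -> {vspace V}) : directv (\sum_i S i) ->
  (forall i, T_module (S i)) -> splits S (Ueta e x eta).
Proof.
move=> S_dx Smod; rewrite /Ueta UspaceE.
have SA i w : w \in S i -> A 1 *m w \in S i by case/T_moduleP: (Smod i) => SA _ /SA.
have SE i j w : w \in S i -> Es j *m w \in S i by case/T_moduleP: (Smod i) => _ SE /SE.
have SL i w : w \in S i -> local_op K e x *m w \in S i.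
  by move=> Sw; rewrite -mxactE (subvP (Smod i _ in_T_local_op)) // memv_img.
apply: splits_cap; first apply: splits_cap.
- apply: (splits_lker S_dx) => i v Sv.
  by rewrite mxactE mulmxBl mul1mx memvB ?SE.
- by apply: (splits_lker S_dx) => i v Sv; rewrite mxactE -mulmxA SE ?SA.
- apply: (splits_lker S_dx) => i v Sv.
  by rewrite add_lfunE opp_lfunE scale_lfunE id_lfunE mxactE memvB ?memvZ ?SL.
Qed.

(** An isomorphism carries the equations of [Ueta] over to [W'].  Conversely a
    nonzero vector in the intersection generates [W'] as a chain, and chains with
    the same coefficients are isomorphic; such a chain meets the second sphere in
    a line. *)
Lemma isomorphic_Ueta (W W' : {vspace V}) : thin_endpoint2 e x eta W -> T_irreducible W' ->
  \dim (Ueta e x eta :&: W') = `[< T_isomorphic e x W W' >] :> nat.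
Proof.
move=> Wthin W'irr; have [v [Uv v0 WE]] := thin_endpoint2_chain Wthin.
have [U0|U0] := eqVneq (Ueta e x eta :&: W')%VS 0%VS.
  rewrite U0 dimv0; case: asboolP => // -[sigma [inj im comm]].
  have Wv : v \in W by rewrite WE (seed_in_chain_mod Gamma_dr D_gt0 (eta_seed Uv)).
  have W'sv : sigma v \in W' by rewrite -im memv_img.
  have [[v2 v1] v_eta] := iffLR (UetaP _ _) Uv.
  have TE i : (i <= D)%N -> in_T e x (Es i) by move=> iD; constructor.
  have commE i : (i <= D)%N -> Es i *m sigma v = sigma (Es i *m v).
    by move=> iD; rewrite comm //; apply: TE.
  have : sigma v \in (Ueta e x eta :&: W')%VS.
    rewrite memv_cap W'sv andbT; apply/UetaP; split; last first.
      by rewrite -(comm _ in_T_local_op) // v_eta linearZ.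
    split; first by rewrite commE // v2.
    have TEA : in_T e x (Es 1 *m A 1) by apply: in_T_mul; [apply: TE | constructor].
    by rewrite mulmxA -(comm _ TEA) // -mulmxA v1 linear0.
  rewrite U0 memv0 => /eqP sv0; case/eqP: v0; apply: inj => //; first exact: mem0v.
  by rewrite sv0 linear0.
have /memv_capP[Uw W'w] := memv_pick (Ueta e x eta :&: W')%VS.
set w := vpick _ in Uw W'w; have w0 : w != 0 by rewrite vpick0.
have W'E := chain_mod_unique Gamma_dr bip D_gt0 (eta_seed Uw) w0 W'irr W'w.
have -> : `[< T_isomorphic e x W W' >] = true.
  apply/asboolP; rewrite WE W'E.
  by apply: (chain_mod_iso Gamma_dr bip D_gt0 (eta_seed Uv) (eta_seed Uw)).
apply/eqP; rewrite eqn_leq lt0n dimv_eq0 U0 andbT.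
suff sub : (Ueta e x eta :&: W' <= <[w]>)%VS.
  by apply: leq_trans (dimvS sub) _; rewrite dim_vline leq_b1.
rewrite -(Estar_chain_mod Gamma_dr D_gt0 (eta_seed Uw)) -W'E.
apply/subvP=> u /memv_capP[/UetaP[[u2 _] _] W'u].
by apply/Estar_imP; exists u.
Qed.

Lemma multiplicity_dim (W : {vspace V}) : thin_endpoint2 e x eta W ->
  multiplicity e x W = \dim (Ueta e x eta).
Proof.
move=> Wthin; have count_dim Ws : orth_decomposition e x Ws ->
    count (fun W' => `[< T_isomorphic e x W W' >]) Ws = \dim (Ueta e x eta).
  move=> [Wsirr Wsorth Wssum]; pose S (i : 'I_(size Ws)) := nth 0%VS Ws i.
  have S_dx : directv (\sum_i S i).
    by apply: orth_directv => i j ij u v; apply: Wsorth.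
  have S_irr i : T_irreducible (S i) by apply/Wsirr/mem_nth.
  have S_sum : (Ueta e x eta <= \sum_i S i)%VS.
    have -> : (\sum_i S i)%VS = fullv by rewrite -Wssum (big_nth 0%VS) big_mkord.
    exact: subvf.
  rewrite (dim_splits S_dx (Ueta_splits S_dx _) S_sum); last by move=> i; case: (S_irr i).
  rewrite -sum1_count big_mkcond (big_nth 0%VS) big_mkord; apply: eq_bigr => i _.
  by rewrite (isomorphic_Ueta Wthin (S_irr i)); case: asbool.
have [Ws0 dec0] := exists_orth_decomposition K x Gamma_dr.
apply: xget_unique => [|_ [Ws dec ->]]; last exact: count_dim.
by exists Ws0; rewrite ?count_dim.
Qed.

Theorem mu_dim : mu e x eta = \dim (Ueta e x eta).
Proof.
have [U0|U0] := eqVneq (Ueta e x eta) 0%VS.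
  rewrite U0 dimv0; apply: xgetPN => m [W Wthin _].
  have [v [Uv v0 _]] := thin_endpoint2_chain Wthin.
  by move: Uv; rewrite U0 memv0 (negPf v0).
apply: xget_unique => [|_ [W Wthin ->]]; last exact: multiplicity_dim.
have Wthin := chain_thin_endpoint2 (memv_pick _) (_ : vpick (Ueta e x eta) != 0).
rewrite vpick0 in Wthin; exists (chain_mod e x 2 (vpick (Ueta e x eta))); first exact: Wthin.
by rewrite multiplicity_dim //; apply: Wthin.
Qed.

End Multiplicity.

End LocalSpace.

(** * Eigenvalues counted by dimensions *)

Section EigenvalueCount.
Variables (K : numClosedFieldType).

Lemma char_poly_similar (F : fieldType) m (P B C : 'M[F]_m) :
  P \in unitmx -> P *m B = C *m P -> char_poly B = char_poly C.
Proof.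
move=> Pu PB; pose PX := map_mx polyC P.
have PX0 : \det PX != 0.
  by rewrite det_map_mx polyC_eq0; move: Pu; rewrite unitmxE unitfE.
apply: (mulfI PX0); rewrite [RHS]mulrC /char_poly -!det_mulmx; congr (\det _).
by rewrite /char_poly_mx mulmxBr mulmxBl -!map_mxM PB scalar_mxC.
Qed.

Lemma dim_eigenspace_cap (vT : vectType K) (f : 'End(vT)) (S : {vspace vT}) l a :
  (forall v, v \in S -> f v = l *: v) ->
  \dim (lker (f - a *: \1%VF) :&: S) = if l == a then \dim S else 0%N.
Proof.
move=> fS; have gE v : v \in S -> (f - a *: \1%VF) v = (l - a) *: v.
  by move=> Sv; rewrite add_lfunE opp_lfunE scale_lfunE id_lfunE fS // scalerBl.
case: eqP => [la|/eqP la].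
  congr (\dim _); apply/vspaceP=> v; rewrite memv_cap memv_ker.
  by case: (boolP (v \in S)) => [/gE ->|]; rewrite ?andbF // la subrr scale0r eqxx.
apply/eqP; rewrite dimv_eq0 -subv0; apply/subvP=> v; rewrite memv_cap memv_ker.
by case/andP=> /[swap] /gE ->; rewrite scaler_eq0 subr_eq0 (negPf la) memv0.
Qed.

(** The summands are invariant, so every eigenspace splits along them. *)
Lemma dim_eigenspace_sum (vT : vectType K) m (S : 'I_m -> {vspace vT})
    (l : 'I_m -> K) (f : 'End(vT)) a :
  directv (\sum_i S i) -> (\sum_i S i)%VS = fullv ->
  (forall i v, v \in S i -> f v = l i *: v) ->
  \dim (lker (f - a *: \1%VF)) = (\sum_(i | l i == a) \dim (S i))%N.
Proof.
move=> S_dx S_full fS; rewrite (dim_splits S_dx); last by rewrite S_full subvf.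
  by rewrite [RHS]big_mkcond; apply: eq_bigr => i _; apply: dim_eigenspace_cap (fS i).
apply: (splits_lker S_dx) => i v Sv.
by rewrite add_lfunE opp_lfunE scale_lfunE id_lfunE (fS i) // memvB ?memvZ.
Qed.

Lemma dim_eigenspace_char_poly m (B : 'M[K]_m) (s : seq K) a :
  B^T = B -> map_mx Num.conj B = B -> char_poly B = \prod_(z <- s) ('X - z%:P) ->
  \dim (lker (linfun (mulmx B : 'cV_m -> 'cV_m) - a *: \1%VF)) = count_mem a s.
Proof.
move=> Bt Bc Bs; have [PB _ _] := real_symmetric_spectral Bt Bc.
have Pu := spectral_unit B; set P := spectralmx B in PB Pu; set dg := spectral_diag B in PB.
have /prod_XsubC_eq/permP -> : \prod_(z <- s) ('X - z%:P) =
    \prod_(z <- [seq dg 0 i | i <- enum 'I_m]) ('X - z%:P).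
  rewrite -Bs (char_poly_similar Pu PB) char_poly_trig ?diag_mx_is_trig //.
  by rewrite big_map big_enum; apply: eq_bigr => i _; rewrite mxE eqxx.
rewrite count_map -sum1_count big_enum_cond /=.
pose S i : {vspace 'cV[K]_m} := <[col i (invmx P)]>%VS.
have lin a' : \sum_i a' i *: col i (invmx P) = invmx P *m \col_i a' i.
  apply/colP=> r; rewrite summxE mxE; apply: eq_bigr => i _.
  by rewrite !mxE mulrC.
rewrite (@dim_eigenspace_sum _ _ S (fun i => dg 0 i)).
- apply: eq_bigr => i _; rewrite dim_vline; case: eqP => // ci0.
  have := congr1 (col i) (mulmxV Pu); rewrite !colE -mulmxA -colE ci0 mulmx0 mul1mx.
  by move/colP/(_ i)/eqP; rewrite !mxE !eqxx eq_sym oner_eq0.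
- apply/directv_sum_independent=> us Sus us0 i _.
  have /all_sig[c cE] j : {c | us j = c *: col j (invmx P)} by apply/cid/vlineP/Sus.
  have : P *m (\sum_j c j *: col j (invmx P)) = 0.
    by rewrite -(eq_bigr _ (fun j _ => cE j)) us0 mulmx0.
  rewrite lin mulKVmx // => /colP/(_ i); rewrite !mxE cE => ->.
  by rewrite scale0r.
- apply/eqP; rewrite eqEsubv subvf; apply/subvP=> v _.
  have -> : v = \sum_i (P *m v) i 0 *: col i (invmx P).
    rewrite lin (_ : \col_i _ = P *m v) ?mulKmx //.
    by apply/colP=> i; rewrite mxE.
  apply: memv_suml => i _; rewrite memvZ //.
  exact: (subvP (sumv_sup i isT (subvv _)) _ (memv_line _)).
move=> i v /vlineP[c ->]; rewrite lfunE /= -scalemxAr scalerA mulrC -scalerA.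
congr (_ *: _); rewrite colE mulmxA -colE.
have -> : B *m invmx P = invmx P *m diag_mx dg.
  by apply: (can_inj (mulKmx Pu)); rewrite mulmxA PB mulmxK // mulKVmx.
by rewrite -colE; apply/colP=> r; rewrite mxE mul_mx_diag !mxE mulrC.
Qed.

End EigenvalueCount.

(** * The local adjacency matrix *)

Section LocalMatrix.
Variables (K : numClosedFieldType) (X : finType) (e : rel X) (x : X).
Hypothesis Gamma_dr : distance_regular e.

Local Notation V := 'cV[K]_#|X|.
Local Notation A := (dist_mx K e).
Local Notation Es := (Estar K e x).
Local Notation N := (local_adj_mx K e x).
Local Notation m := #|{: {y : X | gdist e x y == 2}}|.

Let conn : simple_connected_graph e. Proof. by case: Gamma_dr. Qed.

(** The isometric embedding of the functions on the second sphere into the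
    standard module. *)
Definition sphere2_mx : 'M[K]_(#|X|, m) :=
  \matrix_(r, s) (enum_val r == val (enum_val s))%:R.
Local Notation Phi := sphere2_mx.

Lemma sphere2_mulr p (M : 'M[K]_(p, #|X|)) r s :
  (M *m Phi) r s = M r (enum_rank (val (enum_val s))).
Proof.
rewrite mxE (bigD1 (enum_rank (val (enum_val s)))) //= big1 ?addr0 => [|t ts].
  by rewrite mxE enum_rankK eqxx mulr1.
rewrite mxE (_ : (_ == _) = false) ?mulr0 //; apply/eqP=> tE.
by rewrite -tE enum_valK eqxx in ts.
Qed.

Lemma sphere2_tr_mul : Phi^T *m Phi = 1%:M.
Proof.
apply/matrixP=> r s; rewrite sphere2_mulr !mxE enum_rankK (inj_eq val_inj).
by rewrite (inj_eq enum_val_inj) eq_sym.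
Qed.

Lemma sphere2_mul_tr : Phi *m Phi^T = Es 2.
Proof.
apply/matrixP=> r t; rewrite !mxE.
have [r2|r2] := boolP (gdist e x (enum_val r) == 2).
  pose s := enum_rank (Sub (enum_val r) r2 : {y : X | gdist e x y == 2}).
  rewrite (bigD1 s) //= !mxE enum_rankK SubK eqxx mul1r big1 ?addr0.
    by rewrite (inj_eq enum_val_inj) eq_sym mulr1n.
  move=> u us; rewrite !mxE (_ : (_ == _) = false) ?mul0r //; apply/eqP=> rE.
  case/eqP: us; apply: enum_val_inj; apply: val_inj.
  by rewrite -rE enum_rankK.
rewrite mul0rn big1 // => s _; rewrite !mxE (_ : (_ == _) = false) ?mul0r //.
by apply: contraNF r2 => /eqP ->; apply: (valP (enum_val s)).
Qed.

Lemma local_op_factor : local_op K e x = Phi *m N *m Phi^T.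
Proof.
rewrite /local_op -!sphere2_mul_tr !mulmxA; congr (_ *m _).
rewrite -!mulmxA; congr (_ *m _); apply/matrixP=> r s.
rewrite mulmxA sphere2_mulr -[Phi^T *m _]trmxK trmx_mul trmxK mxE dist_mx_tr //.
by rewrite sphere2_mulr !mxE !enum_rankK gdist_sym.
Qed.

Definition Estar_fix i : {vspace V} := lker (mxact (1%:M - Es i)).

Lemma Estar_fixP i v : (v \in Estar_fix i) = (Es i *m v == v).
Proof. by rewrite memv_ker mxactE mulmxBl mul1mx subr_eq0 eq_sym. Qed.

Lemma dim_local_eigenspace a :
  \dim (Estar_fix 2 :&: passmx.leigenspace (mxact (local_op K e x)) a) =
  \dim (lker (linfun (mulmx N : 'cV_m -> 'cV_m) - a *: \1%VF)).
Proof.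
set Z := lker _; pose f : 'Hom('cV[K]_m, V) := linfun (mulmx Phi).
rewrite -(@limg_dim_eq _ _ _ f Z); last first.
  apply/eqP; rewrite -subv0; apply/subvP=> z; rewrite memv_cap memv0 => /andP[_].
  rewrite memv_ker lfunE /= => /eqP /(congr1 (mulmx Phi^T)).
  by rewrite mulmxA sphere2_tr_mul mul1mx mulmx0 => ->.
have ZP z : (z \in Z) = (N *m z == a *: z).
  by rewrite memv_ker add_lfunE opp_lfunE scale_lfunE id_lfunE lfunE subr_eq0.
congr (\dim _); apply/vspaceP=> v; rewrite memv_cap Estar_fixP mem_leigenspace.
rewrite local_op_factor -sphere2_mul_tr; apply/andP/memv_imgP.
  case=> /eqP v2 /eqP va; exists (Phi^T *m v); last by rewrite lfunE /= mulmxA v2.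
  rewrite ZP scalemxAr -va -!mulmxA [Phi^T *m (Phi *m _)]mulmxA.
  by rewrite sphere2_tr_mul mul1mx.
case=> z; rewrite ZP => /eqP za ->; rewrite lfunE /=.
by rewrite -!mulmxA ![Phi^T *m (Phi *m _)]mulmxA sphere2_tr_mul !mul1mx za scalemxAr !eqxx.
Qed.

Lemma dim_local_eigenspace_count (etas : seq K) a :
  char_poly N = \prod_(z <- etas) ('X - z%:P) ->
  \dim (Estar_fix 2 :&: passmx.leigenspace (mxact (local_op K e x)) a) =
  count_mem a etas.
Proof.
move=> Ns; rewrite dim_local_eigenspace; apply: dim_eigenspace_char_poly => //.
  by apply/matrixP=> r s; rewrite !mxE gdist_sym.
by apply/matrixP=> r s; rewrite !mxE rmorph_nat.
Qed.

Lemma dim_Estar_fix i : \dim (Estar_fix i) = num_between e i i x x.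
Proof.
pose S r : {vspace V} := <[(delta_mx r 0%R : V)]>%VS.
have -> : Estar_fix i = lker (mxact (Es i) - 1 *: \1%VF).
  apply/vspaceP=> v; rewrite Estar_fixP memv_ker.
  by rewrite add_lfunE opp_lfunE scale_lfunE id_lfunE mxactE scale1r subr_eq0.
have sumE (a : 'I_#|X| -> K) : \sum_r a r *: (delta_mx r 0 : V) = \col_r a r.
  apply/colP=> s; rewrite summxE mxE (bigD1 s) //= big1 ?addr0 => [|t ts].
    by rewrite !mxE !eqxx mulr1.
  by rewrite !mxE eq_sym (negPf ts) mulr0.
rewrite (@dim_eigenspace_sum _ _ _ S (fun r => (gdist e x (enum_val r) == i)%:R)).
- rewrite (eq_bigl (fun r => gdist e x (enum_val r) == i)) => [|r]; last first.
    by case: (_ == i); rewrite ?eqxx // eq_sym oner_eq0.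
  rewrite (eq_bigr (fun=> 1%N)) => [|r _]; last first.
    rewrite dim_vline; case: eqP => // /colP/(_ r)/eqP.
    by rewrite !mxE !eqxx oner_eq0.
  rewrite sum1dep_card -(card_imset _ enum_val_inj); apply: eq_card => y.
  rewrite [RHS]inE (gdist_sym conn y x) andbb; apply/imsetP/idP => [[r]|xy].
    by rewrite inE => xr ->.
  by exists (enum_rank y); rewrite ?inE enum_rankK.
- apply/directv_sum_independent=> us Sus us0 r _.
  have /all_sig[a aE] t : {a | us t = a *: delta_mx t 0} by apply/cid/vlineP/Sus.
  move: us0; rewrite (eq_bigr _ (fun t _ => aE t)) sumE => /colP/(_ r).
  by rewrite !mxE aE => ->; rewrite scale0r.
- apply/eqP; rewrite eqEsubv subvf; apply/subvP=> v _.
  have -> : v = \sum_r v r 0 *: (delta_mx r 0 : V).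
    by rewrite sumE; apply/colP=> r; rewrite mxE.
  apply: memv_suml => r _; rewrite memvZ //.
  exact: (subvP (sumv_sup r isT (subvv _)) _ (memv_line _)).
move=> r v /vlineP[a ->]; rewrite mxactE -scalemxAr scalerA mulrC -scalerA.
congr (_ *: _); apply/colP=> s; rewrite EstarE !mxE.
by case: (s =P r) => [->|_]; rewrite ?mulr0.
Qed.

Lemma card_sphere2 : m = \dim (Estar_fix 2).
Proof.
rewrite dim_Estar_fix card_sig; apply: eq_card => y.
by rewrite !inE (gdist_sym conn y x) andbb.
Qed.

End LocalMatrix.

(** * The orthogonal splitting of the second sphere *)

Section SecondSphere.
Variables (K : numClosedFieldType) (X : finType) (e : rel X) (x : X).
Hypothesis Gamma_dr : distance_regular e.
Hypothesis bip : bipartite e.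
Hypothesis D_ge4 : (4 <= diameter e)%N.

Local Notation V := 'cV[K]_#|X|.
Local Notation D := (diameter e).
Local Notation A := (dist_mx K e).
Local Notation Es := (Estar K e x).
Local Notation b i := (b_num e i)%:R.
Local Notation c i := (c_num e i)%:R.
Local Notation xhat := (xhat K x).
Local Notation Estar_fix := (Estar_fix K e x).
Local Notation lowest_space := (lowest_space K e x).
Local Notation local_op := (local_op K e x).

Let conn : simple_connected_graph e. Proof. by case: Gamma_dr. Qed.
Let D_gt0 : (0 < D)%N. Proof. exact: leq_trans D_ge4. Qed.
Let D_gt1 : (1 < D)%N. Proof. exact: leq_trans D_ge4. Qed.
Let seed_xhat : seed e x 0 (fun=> 0) xhat.
Proof. exact: (seed0 Gamma_dr bip (Estar_xhat K x Gamma_dr)). Qed.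

(** The characteristic vector of the second sphere; see [sphere2E]. *)
Definition sphere2 : V := chain e x 0 xhat 2.

(** The vectors on the first sphere whose entries sum to zero. *)
Definition sum_zero1 : {vspace V} := (Estar_fix 1 :&: lker (mxact (Es 0 *m A 1)))%VS.
Definition endpoint1_part : {vspace V} := (mxact (Es 2 *m A 1) @: sum_zero1)%VS.

Lemma sum_zero1P w : w \in sum_zero1 ->
  Es 1 *m w = w /\ Es 0 *m (A 1 *m w) = 0.
Proof. by rewrite memv_cap Estar_fixP memv_ker mxactE -mulmxA => /andP[/eqP ? /eqP ?]. Qed.

Lemma seed_sum_zero1 w : w \in sum_zero1 -> seed e x 1 (fun _ => -1) w.
Proof. by move=> /sum_zero1P[w1 w0]; apply: seed1. Qed.

Lemma raise_sum_zero1 w : w \in sum_zero1 ->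
  Es 2 *m (A 1 *m w) = chain e x 1 w 1.
Proof.
move=> /seed_sum_zero1 ws; have := chain_raise Gamma_dr bip D_gt0 ws 0.
by rewrite (chain0 Gamma_dr ws) (c_num1 Gamma_dr x) // scale1r.
Qed.

Lemma sphere1_dual : Es 0 *m (A 1 *m chain e x 0 xhat 1) = b 0 *: xhat.
Proof.
have := chain_lower Gamma_dr bip D_gt0 seed_xhat 0; rewrite (chain0 Gamma_dr seed_xhat).
by move=> ->; rewrite /beta mulr0 add0r (c_num0 Gamma_dr x) mul0r subr0.
Qed.

Lemma dim_sum_zero1 : (\dim sum_zero1).+1 = valency e.
Proof.
have <- : \dim (Estar_fix 1) = valency e.
  rewrite dim_Estar_fix // num_betweenE // gdistxx //.
rewrite -(limg_ker_dim (mxact (Es 0 *m A 1)) (Estar_fix 1)) -addn1; congr (_ + _)%N.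
suff -> : (mxact (Es 0 *m A 1) @: Estar_fix 1)%VS = <[xhat]>%VS.
  by rewrite dim_vline xhat_neq0.
apply/eqP; rewrite eqEsubv; apply/andP; split.
  apply/subvP=> _ /memv_imgP[w _ ->]; rewrite mxactE -mulmxA (Estar0E _ Gamma_dr).
  by rewrite memvZ ?memv_line.
rewrite -memvE -(memv_scale _ _ (b_neq0 K x Gamma_dr D_gt0)) -sphere1_dual mulmxA -mxactE.
by rewrite memv_img // Estar_fixP (Estar_chain e x 0 xhat 1).
Qed.

(** Raising is injective, because lowering the result multiplies by
    [b 0 - c 2 = b 2]. *)
Lemma dim_endpoint1_part : (\dim endpoint1_part).+1 = valency e.
Proof.
rewrite -dim_sum_zero1; congr _.+1; apply: limg_dim_eq.
apply/eqP; rewrite -subv0; apply/subvP=> w; rewrite memv_cap memv_ker mxactE -mulmxA.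
case/andP=> w0 /eqP Ew; have ws := seed_sum_zero1 w0.
have := chain_lower Gamma_dr bip D_gt0 ws 0.
rewrite -raise_sum_zero1 // Ew !mulmx0 (chain0 Gamma_dr ws) => /esym/eqP.
rewrite scaler_eq0 /beta (c_num0 Gamma_dr x) mul0r subr0 mulrN1.
rewrite (_ : _ + _ = b 2) ?(negPf (b_neq0 K x Gamma_dr _)) ?memv0 //; first exact: leq_trans D_ge4.
rewrite addrC; apply/eqP; rewrite subr_eq -natrD.
by rewrite (bc_valency Gamma_dr x bip) // (leq_trans _ D_ge4).
Qed.

Lemma dist2E (v : V) : c 2 *: (A 2 *m v) = A 1 *m (A 1 *m v) - b 0 *: v.
Proof.
by rewrite mulmxA dist_mx_mulS // dist_mx0 // mulmxDl -!scalemxAl mul1mx addrK.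
Qed.

(** Replace [A 2] by [A 1 *m A 1] and use the coefficients of the chain. *)
Lemma local_op_endpoint1 v : v \in endpoint1_part -> local_op *m v = (b 3 - 1) *: v.
Proof.
move=> /memv_imgP[w w0 ->]; rewrite mxactE -mulmxA raise_sum_zero1 //.
have ws := seed_sum_zero1 w0; set y := chain e x 1 w 1.
have Ey : Es 2 *m y = y by apply: (Estar_chain e x 1 w 1).
rewrite /local_op -!mulmxA Ey.
have c2 := c_neq0 K x Gamma_dr D_gt1.
apply: (scalerI c2); rewrite scalemxAr dist2E mulmxBr -scalemxAr Ey.
rewrite [X in A 1 *m X](dist_chainS Gamma_dr bip D_gt0 ws) mulmxDr -!scalemxAr mulmxDr -!scalemxAr.
rewrite (chain_lower Gamma_dr bip D_gt0 ws 1) (chain0 Gamma_dr ws) raise_sum_zero1 // -/y.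
rewrite !scalerA -scalerDl -scalerBl; congr (_ *: _).
rewrite /beta (c_num0 Gamma_dr x) (c_num1 Gamma_dr x) //.
have bc i : (i <= 4)%N -> b i = (valency e)%:R - c i :> K.
  move=> i4; rewrite -(bc_valency Gamma_dr x bip (leq_trans i4 D_ge4)).
  by rewrite natrD addrK.
by rewrite (bc 0%N) // (bc 1%N) // (bc 3%N) // (c_num1 Gamma_dr x) // (c_num0 Gamma_dr x); ring.
Qed.

Lemma sphere2E r : sphere2 r 0 = (gdist e x (enum_val r) == 2)%:R.
Proof.
rewrite /sphere2 /chain add0n EstarE mxE (bigD1 (enum_rank x)) //= big1 => [|s sx].
  by rewrite !mxE enum_rankK eqxx mulr1 addr0 (gdist_sym conn _ x) -natrM mulnb andbb.
by rewrite !mxE (negPf sx) mulr0.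
Qed.

Lemma local_op_sphere2 : local_op *m sphere2 = (inter_num e 2 2 2)%:R *: sphere2.
Proof.
rewrite /local_op -!mulmxA [Es 2 *m sphere2](Estar_chain e x 0 xhat 2).
apply/colP=> r; rewrite EstarE mxE [RHS]mxE sphere2E.
case: eqP => [xr|_]; last by rewrite mul0r mulr0.
rewrite mul1r mulr1.
have <- : num_between e 2 2 (enum_val r) x = inter_num e 2 2 2.
  by rewrite num_betweenE // (gdist_sym conn _ x) xr.
rewrite num_between_sum -[RHS]big_enum_val_all; apply: eq_bigr => s _.
by rewrite mxE sphere2E -natrM mulnb (gdist_sym conn x).
Qed.

Lemma sphere2_neq0 : sphere2 != 0.
Proof.
have [y xy] := level_nonempty Gamma_dr x D_gt1.
apply/eqP=> /colP/(_ (enum_rank y))/eqP.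
by rewrite sphere2E enum_rankK xy eqxx mxE oner_eq0.
Qed.

(** A vector on the first sphere is a multiple of the characteristic vector of
    this sphere plus a vector of sum zero. *)
Lemma raise_Estar1 w : Es 1 *m w = w ->
  Es 2 *m (A 1 *m w) \in (<[sphere2]> + endpoint1_part)%VS.
Proof.
move=> w1; pose x1 := chain e x 0 xhat 1.
have b0 := b_neq0 K x Gamma_dr D_gt0.
have [a aE] : exists a, Es 0 *m (A 1 *m w) = (a * b 0) *: xhat.
  rewrite (Estar0E _ Gamma_dr); set z := (_ *m _) _ _.
  by exists (z / b 0); rewrite divfK.
have Ex1 : Es 1 *m x1 = x1 by apply: (Estar_chain e x 0 xhat 1).
have w'0 : w - a *: x1 \in sum_zero1.
  rewrite memv_cap Estar_fixP memv_ker mxactE -mulmxA !mulmxBr -!scalemxAr Ex1 w1 eqxx /=.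
  by rewrite sphere1_dual aE scalerA subrr.
have -> : w = a *: x1 + (w - a *: x1) by rewrite addrC subrK.
move: (w - a *: x1) w'0 => w' w'0; rewrite !mulmxDr memv_add //.
  rewrite -!scalemxAr memvZ // (chain_raise Gamma_dr bip D_gt0 seed_xhat 1).
  by rewrite memvZ ?memv_line.
by rewrite mulmxA -mxactE memv_img.
Qed.

Lemma orth_lowestP v : Es 2 *m v = v ->
  (forall u, u \in (<[sphere2]> + endpoint1_part)%VS -> inner v u = 0) <->
  Es 1 *m (A 1 *m v) = 0.
Proof.
move=> v2; split=> [vorth|v1 u].
  apply/eqP; rewrite -inner_eq0; apply/eqP; set w := Es 1 *m _.
  have w1 : Es 1 *m w = w by apply: EstarK.
  rewrite {1}/w inner_Estar w1 inner_dist // -[X in inner X _]v2 inner_Estar.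
  exact/vorth/raise_Estar1.
case/memv_addP=> _ /vlineP[a ->] [_ /memv_imgP[w w0 ->] ->].
rewrite mxactE -mulmxA raise_sum_zero1 // innerDr innerZr.
rewrite (lowest_chain Gamma_dr bip D_gt1 seed_xhat) // mulr0 add0r.
by rewrite (lowest_chain Gamma_dr bip D_gt1 (seed_sum_zero1 w0)).
Qed.

Definition parts : seq {vspace V} := [:: <[sphere2]>%VS; endpoint1_part; lowest_space].
Definition part (i : 'I_3) : {vspace V} := nth 0%VS parts i.

Lemma parts_orth i j : i != j -> forall u v, u \in part i -> v \in part j -> inner u v = 0.
Proof.
suff lt_ij : forall i j : 'I_3, (i < j)%N ->
    forall u v, u \in part i -> v \in part j -> inner u v = 0.
  rewrite -val_eqE neq_ltn => /orP[/lt_ij //|/lt_ij ji] u v ui vj.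
  by rewrite innerC ji ?rmorph0.
have low u v : u \in (<[sphere2]> + endpoint1_part)%VS -> v \in lowest_space -> inner u v = 0.
  move=> Qu /(iffLR (mem_lowest_space _ _ _))[v2 v1].
  by rewrite innerC (iffRL (orth_lowestP v2)) ?rmorph0.
case=> [[|[|[|//]]] ?] [[|[|[|//]]] ?] //= _ u v; rewrite /part /=.
- move=> /vlineP[a ->] /memv_imgP[w w0 ->]; rewrite mxactE -mulmxA innerZl.
  rewrite -inner_Estar [Es 2 *m sphere2](Estar_chain e x 0 xhat 2) -inner_dist //.
  have [w1 w0'] := sum_zero1P w0; rewrite -w1 -inner_Estar.
  rewrite (chain_lower Gamma_dr bip D_gt0 seed_xhat 1) innerZl /chain add0n inner_Estar w1.
  by rewrite inner_dist // -(Estar_xhat K x Gamma_dr) inner_Estar w0' inner0r !mulr0.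
- by move=> u0; apply: low; apply: (subvP (addvSl _ _)).
- by move=> u0; apply: low; apply: (subvP (addvSr _ _)).
Qed.

Lemma parts_sum : (\sum_i part i)%VS = Estar_fix 2.
Proof.
rewrite !big_ord_recl big_ord0 addv0 /part /=.
have sub1 : (<[sphere2]> <= Estar_fix 2)%VS.
  by rewrite -memvE Estar_fixP (Estar_chain e x 0 xhat 2).
have sub2 : (endpoint1_part <= Estar_fix 2)%VS.
  apply/subvP=> _ /memv_imgP[w _ ->]; rewrite Estar_fixP mxactE -mulmxA.
  by rewrite EstarK.
rewrite addvA; set Q := (_ + endpoint1_part)%VS.
have subQ : (Q <= Estar_fix 2)%VS by rewrite subv_add sub1.
have -> : lowest_space = (orthv Q :&: Estar_fix 2)%VS.
  apply/vspaceP=> v; rewrite [in RHS]memv_cap Estar_fixP; apply/idP/andP.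
    case/(iffLR (mem_lowest_space _ _ _)) => v2 v1; rewrite v2 eqxx.
    by split=> //; apply/orthvP/orth_lowestP.
  case=> /orthvP vQ /eqP v2; apply/(iffRL (mem_lowest_space _ _ _)).
  by split=> //; apply/orth_lowestP.
by rewrite vspace_modl // orthv_add capfv.
Qed.

Lemma part_dx : directv (\sum_i part i).
Proof. by apply: orth_directv; apply: parts_orth. Qed.

Lemma valency_le_dim : (valency e <= \dim (Estar_fix 2))%N.
Proof.
rewrite -parts_sum (directvP part_dx) /= !big_ord_recl /part /= dim_vline sphere2_neq0.
by rewrite -dim_endpoint1_part addnA add1n leq_addr.
Qed.

(** On the first two parts the operator is a scalar; the third is their
    orthogonal complement, and the operator is self-adjoint. *)
Lemma part_stable i v : v \in part i -> local_op *m v \in part i.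
Proof.
have Q_stable u : u \in (<[sphere2]> + endpoint1_part)%VS ->
    local_op *m u \in (<[sphere2]> + endpoint1_part)%VS.
  case/memv_addP=> _ /vlineP[a ->] [p Pp ->]; rewrite mulmxDr memv_add //.
    by rewrite -scalemxAr local_op_sphere2 !memvZ ?memv_line.
  by rewrite local_op_endpoint1 ?memvZ.
case: i => [[|[|[|//]]] ?]; rewrite /part /=.
- by move=> /vlineP[a ->]; rewrite -scalemxAr local_op_sphere2 !memvZ ?memv_line.
- by move=> Pv; rewrite local_op_endpoint1 ?memvZ.
case/(iffLR (mem_lowest_space _ _ _)) => v2 v1; apply/(iffRL (mem_lowest_space _ _ _)).
have Lv2 : Es 2 *m (local_op *m v) = local_op *m v.
  by rewrite /local_op -!mulmxA EstarK.
split=> //; apply/(orth_lowestP Lv2) => u Qu.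
rewrite /local_op -!mulmxA inner_Estar inner_dist // inner_Estar !mulmxA -/local_op.
by apply: (iffRL (orth_lowestP v2) v1); apply: Q_stable.
Qed.

Lemma dim_local_eigenspace_Ueta a :
  \dim (Estar_fix 2 :&: passmx.leigenspace (mxact local_op) a) =
  (((inter_num e 2 2 2)%:R == a)%R + (if (b 3 - 1 == a)%R then (valency e).-1 else 0)
     + \dim (Ueta e x a))%N.
Proof.
have lopE v : mxact local_op v = local_op *m v := mxactE _ v.
set L := passmx.leigenspace _ _.
have L_splits : splits part (Estar_fix 2 :&: L)%VS.
  apply: splits_cap; apply: (splits_lker part_dx) => i v Sv.
    have := subvP (sumv_sup i isT (subvv _)) _ Sv; rewrite parts_sum Estar_fixP => /eqP v2.
    by rewrite mxactE mulmxBl mul1mx v2 subrr mem0v.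
  by rewrite add_lfunE opp_lfunE scale_lfunE id_lfunE lopE memvB ?memvZ ?part_stable.
have capE i : (Estar_fix 2 :&: L :&: part i)%VS = (L :&: part i)%VS.
  apply/vspaceP=> v; rewrite !memv_cap.
  case: (boolP (v \in part i)) => [iv|]; last by rewrite !andbF.
  have := subvP (sumv_sup i isT (subvv _)) _ iv.
  by rewrite parts_sum => ->.
rewrite (dim_splits part_dx L_splits); last by rewrite parts_sum capvSl.
rewrite !big_ord_recl big_ord0 addn0 !capE /part /= addnA; congr (_ + _ + _)%N.
- rewrite (@dim_eigenspace_cap _ _ _ _ (inter_num e 2 2 2)%:R).
    by rewrite dim_vline sphere2_neq0; case: eqP.
  move=> _ /vlineP[z ->]; rewrite lopE -scalemxAr local_op_sphere2 !scalerA.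
  by rewrite mulrC.
- rewrite (@dim_eigenspace_cap _ _ _ _ (b 3 - 1)); first by rewrite -dim_endpoint1_part.
  by move=> v Pv; rewrite lopE local_op_endpoint1.
by rewrite capvC /Ueta (UspaceE K x Gamma_dr bip D_gt1).
Qed.

(** The first [valency e] entries of the list are the eigenvalues on the first
    two parts. *)
Theorem dim_Ueta_mult (etas : seq K) a :
  ordered_local_eigenvalues e x etas -> \dim (Ueta e x a) = mult_local e etas a.
Proof.
move=> [etas_char etas0 etas_k].
have := dim_local_eigenspace_count Gamma_dr a etas_char.
rewrite dim_local_eigenspace_Ueta /mult_local -{1}(cat_take_drop (valency e) etas) count_cat.
have size_etas : (valency e <= size etas)%N.
  apply: leq_trans valency_le_dim _; rewrite -card_sphere2 // -ltnS.
  by rewrite -(size_char_poly (local_adj_mx K e x)) etas_char size_prod_XsubC.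
have k0 : (0 < valency e)%N by rewrite -dim_endpoint1_part.
have -> : take (valency e) etas = (inter_num e 2 2 2)%:R :: nseq (valency e).-1 (b 3 - 1).
  apply: (@eq_from_nth _ 0); first by rewrite size_takel //= size_nseq prednK.
  move=> i; rewrite size_takel // => ik; rewrite nth_take //.
  case: i ik => [|i] ik //=; rewrite nth_nseq (_ : (i < _)%N) ?(etas_k i.+2) //.
    by rewrite -ltnS prednK.
rewrite /= count_nseq /=; case: (b 3 - 1 == a); rewrite ?mul1n ?mul0n => /addnI //.
Qed.

End SecondSphere.

(** * The spectrum *)

Local Open Scope complex_scope.

Section Spectrum.
Variables (R : realType) (X : finType) (e : rel X) (x : X) (theta : nat -> R).
Hypothesis Gamma_dr : distance_regular e.
Hypothesis bip : bipartite e.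

Local Notation K := R[i].
Local Notation D := (diameter e).
Local Notation A := (dist_mx K e).

Hypothesis D_gt0 : (0 < D)%N.
Hypothesis theta_decr : forall i j : nat, (i < j <= D)%N -> theta j < theta i.
Hypothesis theta_eig : forall a : K, eigenvalue (A 1) a <->
       exists2 i : nat, (i <= D)%N & a = (theta i)%:C.

Lemma real_complex_real (r : R) : r%:C \is Num.real.
Proof. by rewrite realE -[0]/(0%:C) !lecR; apply: le_total. Qed.

Lemma theta_le i j : (i <= j <= D)%N -> theta j <= theta i.
Proof.
rewrite leq_eqVlt => /andP[/predU1P[->//|ij] jD].
by rewrite ltW // theta_decr // ij.
Qed.

Lemma theta_eigenvalue i : (i <= D)%N -> eigenvalue (A 1) (theta i)%:C.
Proof. by move=> iD; apply/theta_eig; exists i. Qed.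

(** The valency is an eigenvalue, with constant eigenvectors, and it bounds the
    others. *)
Lemma theta0_valency : (theta 0)%:C = (valency e)%:R.
Proof.
have k_eig : eigenvalue (A 1) (valency e)%:R.
  apply: (eigenseq_eigenvalue x Gamma_dr bip (eigenseq_const K x Gamma_dr bip)).
  exact: oner_neq0.
have [i iD kE] := iffLR (theta_eig _) k_eig.
have := eigenvalue_le_valency x Gamma_dr bip (theta_eigenvalue (leq0n D)) (real_complex_real _).
rewrite kE lecR => le0; congr _%:C; apply/eqP; rewrite eq_le le0 /=.
by apply: theta_le; rewrite leq0n.
Qed.

(** The spectrum of a bipartite graph is symmetric, and two decreasing
    enumerations of the same set agree. *)
Lemma theta_opp i : (i <= D)%N -> theta i = - theta (D - i).
Proof.
have opp j : (j <= D)%N -> exists2 h, (h <= D)%N & - theta j = theta h.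
  move=> jD; have tj := cosine_eigenseq x Gamma_dr bip D_gt0 (theta_eigenvalue jD).
  have := eigenseq_eigenvalue x Gamma_dr bip (eigenseq_alt x Gamma_dr tj).
  rewrite expr0 mul1r => /(_ (oner_neq0 _))/theta_eig[h hD hE].
  by exists h => //; apply: complexI; rewrite -hE rmorphN.
pose s1 := mkseq theta D.+1; pose s2 := mkseq (fun i => - theta (D - i)%N) D.+1.
suff s12 : s1 = s2.
  by move=> iD; have := congr1 (fun s => s`_i) s12; rewrite !nth_mkseq.
apply: (@irr_sorted_eq _ (fun a b => b < a)); first by move=> a b c ab bc; apply: lt_trans ab.
- by move=> a; apply: ltxx.
- apply/(sortedP 0) => j; rewrite size_mkseq => jD.
  by rewrite (nth_mkseq 0 theta jD) (nth_mkseq 0 theta (ltnW jD)) theta_decr ?leqnn.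
- apply/(sortedP 0) => j; rewrite size_mkseq => jD.
  pose f h := - theta (D - h)%N.
  by rewrite (nth_mkseq 0 f jD) (nth_mkseq 0 f (ltnW jD)) ltrN2 theta_decr //; lia.
move=> a; apply/mapP/mapP=> -[j]; rewrite mem_iota add0n => /andP[_ jD] ->.
  have [h hD hE] := opp j jD; exists (D - h)%N; first by rewrite mem_iota; lia.
  by rewrite subKn // -hE opprK.
have [h hD hE] := opp (D - j)%N (leq_subr _ _); exists h => //.
by rewrite mem_iota.
Qed.

(** For [n = 1] no eigenvalue lies strictly between [theta n] and the valency.  For
    [D] odd and [n = D./2] none lies strictly between [theta n] and
    [- theta n = theta n.+1]. *)
Lemma cosine_neq n : n = 1%N \/ (odd D /\ n = D./2) ->
  forall m, (0 < m < D)%N ->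
    cosine e (theta n)%:C m.-1 != cosine e (theta n)%:C m.+1.
Proof.
move=> n_choice.
have nD : (n <= D)%N by case: n_choice => [->|[_ ->]]; lia.
have tu := cosine_eigenseq x Gamma_dr bip D_gt0 (theta_eigenvalue nD).
have u_re j : cosine e (theta n)%:C j \is Num.real by apply/cosine_real/real_complex_real.
move=> m m_lt; case: n_choice => [n1|[D_odd nd]].
  apply: (eigenseq_neq_top x Gamma_dr bip tu) => //.
    rewrite -theta0_valency n1; apply/eqP=> /complexI t10.
    by have := @theta_decr 0%N 1%N D_gt0; rewrite t10 ltxx.
  move=> l /theta_eig[i iD ->]; rewrite -theta0_valency -!rmorphB -rmorphM /=.
  rewrite -[0]/(0%:C) lecR n1; case: i iD => [|i] iD; first by rewrite subrr mulr0.
  by rewrite mulr_ge0 ?subr_ge0 ?theta_le.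
have Dd : D = (n + n).+1 by rewrite nd addnn -[in LHS](odd_double_half D) D_odd.
have tN : theta n.+1 = - theta n by rewrite theta_opp Dd; [congr (- theta _) |]; lia.
have t_gt0 : 0 < theta n.
  have : theta n.+1 < theta n by apply: theta_decr; lia.
  by rewrite tN -subr_gt0 opprK -mulr2n pmulrn_lgt0.
apply: (eigenseq_neq_mid x Gamma_dr bip tu) => //.
- by apply/eqP=> /complexI t0; rewrite t0 ltxx in t_gt0.
- exact: real_complex_real.
move=> l /theta_eig[i iD ->].
have -> : ((theta n)%:C - (theta i)%:C) * (- (theta n)%:C - (theta i)%:C) =
    ((theta n - theta i) * (- theta n - theta i))%:C.
  by rewrite rmorphM !rmorphB rmorphN.
rewrite -[0]/(0%:C) lecR; case: (leqP i n) => [i_n|n_i].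
  have ti : theta n <= theta i by apply: theta_le; rewrite i_n.
  by rewrite mulr_le0 // subr_le0 // (le_trans _ ti) // (le_trans _ (ltW t_gt0)) // oppr_le0 ltW.
have ti : theta i <= - theta n by rewrite -tN; apply: theta_le; rewrite n_i.
by rewrite mulr_ge0 // subr_ge0 // (le_trans ti) // (le_trans _ (ltW t_gt0)) // oppr_le0 ltW.
Qed.

End Spectrum.

Lemma ordered_local_eigenvalues_complex (R : realType) (X : finType) (e : rel X)
    (x : X) (etas : seq R) : ordered_local_eigenvalues e x etas ->
  ordered_local_eigenvalues e x [seq r%:C | r <- etas].
Proof.
move=> [etas_char etas0 etas_k].
have nthE i : [seq r%:C | r <- etas]`_i = (etas`_i)%:C.
  by have [lt_i|ge_i] := ltnP i (size etas); [rewrite (nth_map 0) | rewrite !nth_default ?size_map].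
split.
- have -> : local_adj_mx R[i] e x = map_mx (real_complex R) (local_adj_mx R e x).
    by apply/matrixP=> r s; rewrite !mxE rmorph_nat.
  rewrite -map_char_poly etas_char rmorph_prod big_map /=.
  by apply: eq_bigr => a _; rewrite rmorphB /= map_polyX map_polyC.
- by rewrite nthE etas0 rmorph_nat.
- by move=> i ik; rewrite nthE etas_k // rmorphB rmorph_nat rmorph1.
Qed.

Theorem theorem14p5 (R : realType) (X : finType) (e : rel X) (x : X)
    (theta : nat -> R) (n : nat) (etas : seq R) (eta : R)
    (Gamma_dr : distance_regular e)
    (Gamma_bip : bipartite e)
    (D_ge4 : (4 <= diameter e)%N)
    (k_ge3 : (3 <= valency e)%N)
    (theta_decr : forall i j : nat, (i < j <= diameter e)%N -> theta j < theta i)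
    (theta_eig : forall a : R[i], eigenvalue (dist_mx R[i] e 1) a <->
       exists2 i : nat, (i <= diameter e)%N & a = (theta i)%:C)
    (n_choice : n = 1%N \/ (odd (diameter e) /\ n = (diameter e)./2))
    (eta_def : eta = - 1 - ((b_num e 2)%:R * (b_num e 3)%:R)
                           / (theta n ^+ 2 - (b_num e 2)%:R))
    (etas_local : ordered_local_eigenvalues e x etas) :
  mu e x eta%:C = \dim (Ueta e x eta%:C) /\
  \dim (Ueta e x eta%:C) = mult_local e etas eta.
Proof.
have D_gt0 : (0 < diameter e)%N by apply: leq_trans D_ge4.
have D_gt1 : (1 < diameter e)%N by apply: leq_trans D_ge4.
split; last first.
  rewrite (dim_Ueta_mult Gamma_dr Gamma_bip D_ge4 _ (ordered_local_eigenvalues_complex etas_local)).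
  rewrite /mult_local -map_drop count_map; apply: eq_count => a /=.
  exact: (inj_eq (@complexI R)).
have nD : (n <= diameter e)%N.
  by case: n_choice => [->|[_ ->]]; lia.
have etaC : eta%:C = - 1 - ((b_num e 2)%:R * (b_num e 3)%:R)
                           / ((theta n)%:C ^+ 2 - (b_num e 2)%:R).
  by rewrite eta_def rmorphB rmorphN1 fmorph_div rmorphM rmorphB rmorphXn !rmorph_nat.
apply: (mu_dim Gamma_dr Gamma_bip D_gt1) => v.
move=> /(iffLR (UetaP x Gamma_dr Gamma_bip D_gt1 _ _)) [[v2 v1] v_eta].
apply: (seed2 Gamma_dr Gamma_bip D_ge4 _ _ _ etaC v2 v1 v_eta).
- exact: theta_eigenvalue.
- exact: real_complex_real.
- exact: (cosine_neq x Gamma_dr Gamma_bip D_gt0 theta_decr theta_eig).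
Qed.
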